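(* Suppose $M\prec\langle H_\theta,\in\rangle$ is a $\delta$-guessing model for some cardinal $\delta<\kappa_M$ and some regular cardinal $\theta>\kappa_M$. Then for every regular cardinal $\lambda\ge\kappa_M$ with $\lambda\in M\cap\theta$ and $\sup(M\cap\lambda)<\lambda$, the principle $\square_{\mathrm{cof}(<\kappa_M)}(\kappa_M,\lambda)$ fails.
   Context: $\kappa_M$ is the least ordinal $\alpha\in M$ with $M\cap\alpha\ne\alpha$. For a cardinal $\delta\le\kappa_M$, $X\in M$, $d\subseteq X$ with $d\in H_\theta$: $d$ is $(\delta,M)$-approximated if $d\cap Z\in M$ for all $Z\in M$ with $|Z|<\delta$; $d$ is $M$-guessed if $d\cap M=e\cap M$ for some $e\in M\cap P(X)$; $M$ is $\delta$-guessing if for all $X\in M$ every $(\delta,M)$-approximated subset of $X$ is $M$-guessed. For a class $E$ of ordinals and cardinals $\kappa,\lambda$, a $\square_E(\kappa,\lambda)$-sequence is $\langle\mathcal{C}_\alpha:\alpha\in\mathrm{Lim}\cap E\cap\lambda\rangle$ such that: $0<|\mathcal{C}_\alpha|<\kappa$; each $C\in\mathcal{C}_\alpha$ is club in $\alpha$; for $C\in\mathcal{C}_\alpha$ and $\beta$ a limit point of $C$ (with $\beta\in E$), $C\cap\beta\in\mathcal{C}_\beta$; and there is no club $D\subseteq\lambda$ with $D\cap\delta'\in\mathcal{C}_{\delta'}$ for all limit points $\delta'$ of $D$ in $E\cap\lambda$. $\square_E(\kappa,\lambda)$ holds if such a sequence exists. $\mathrm{cof}(<\kappa)$ is the class of ordinals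 of cofinality $<\kappa$. *)

(* Defs.v *)
From mathcomp Require Import all_boot.
From mathcomp Require Import boolp classical_sets functions cardinality.

Set Implicit Arguments.
Unset Strict Implicit.
Unset Printing Implicit Defensive.

Local Open Scope classical_set_scope.
Local Open Scope card_scope.

(* The universe of sets in which the statement is interpreted. Replacement is
   stated for all class relations of the metatheory, with parameters; it yields
   full separation. Hence every class contained in a set is a set, omega is
   standard, and every class function restricted to a set is a set: the
   functions, bijections and sequences quantified over below as functions
   [V -> V], and first-order satisfaction over the metatheoretic formulas
   [fml], coincide with their internal counterparts. *)
Record zfc_universe := ZFCUniverse {
  carrier :> Type;
  elem : carrier -> carrier -> Prop;
  zfc_extensionality : forall x y, (forall z, elem z x <-> elem z y) -> x = y;
  zfc_foundation : forall x, (exists y, elem y x) ->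
    exists2 y, elem y x & forall z, elem z y -> ~ elem z x;
  zfc_pairing : forall x y, exists p, forall z, elem z p <-> z = x \/ z = y;
  zfc_union : forall x, exists u, forall z,
    elem z u <-> exists2 y, elem y x & elem z y;
  zfc_powerset : forall x, exists p, forall y,
    elem y p <-> (forall z, elem z y -> elem z x);
  zfc_infinity : exists w,
    (exists2 e, elem e w & forall z, ~ elem z e) /\
    (forall x, elem x w ->
       exists2 s, elem s w & forall z, elem z s <-> elem z x \/ z = x);
  zfc_replacement : forall (a : carrier) (R : carrier -> carrier -> Prop),
    (forall x y y', elem x a -> R x y -> R x y' -> y = y') ->
    exists b, forall y, elem y b <-> exists2 x, elem x a & R x y;
  zfc_choice : forall a,
    (forall x, elem x a -> exists y, elem y x) ->
    (forall x y z, elem x a -> elem y a -> elem z x -> elem z y -> x = y) ->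
    exists c, forall x, elem x a -> exists y, forall z,
      (elem z c /\ elem z x) <-> z = y
}.

Notation "x ∈ y" := (elem x y) (at level 70, no associativity).

Section SetTheory.
Variable V : zfc_universe.
Implicit Types (x y a c d e m D M X Z : V) (A E : set V).
Implicit Types (alpha beta gamma mu kappa lambda theta delta : V).

Definition ext x : set V := [set y | y ∈ x].

(* The class A is a set, and this set is an element of m. *)
Definition set_in A m : Prop := exists2 x, x ∈ m & ext x = A.

Definition transitive_set x : Prop := forall y, y ∈ x -> ext y `<=` ext x.

(* By foundation, a trichotomous membership relation is a well-order. *)
Definition is_ordinal x : Prop :=
  transitive_set x /\
  (forall y z, y ∈ x -> z ∈ x -> [\/ y ∈ z, y = z | z ∈ y]).

Definition le_ord alpha beta : Prop := alpha ∈ beta \/ alpha = beta.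

Definition limit_ordinal alpha : Prop :=
  [/\ is_ordinal alpha, ext alpha !=set0 &
      forall beta, beta ∈ alpha -> exists2 gamma, gamma ∈ alpha & beta ∈ gamma].

Definition is_sup A alpha : Prop :=
  [/\ is_ordinal alpha,
      forall beta, A beta -> le_ord beta alpha &
      forall gamma, is_ordinal gamma -> (forall beta, A beta -> le_ord beta gamma) ->
        le_ord alpha gamma].

Definition is_cardinal mu : Prop :=
  is_ordinal mu /\ forall beta, beta ∈ mu -> ~ (ext beta #= ext mu).

Definition is_card x mu : Prop := is_cardinal mu /\ ext x #= ext mu.

Definition card_lt x kappa : Prop := exists2 mu, is_card x mu & mu ∈ kappa.

Definition cofinal_subset a alpha : Prop :=
  ext a `<=` ext alpha /\
  forall beta, beta ∈ alpha -> exists2 gamma, gamma ∈ a & le_ord beta gamma.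

Definition is_cof alpha mu : Prop :=
  (exists2 a, cofinal_subset a alpha & is_card a mu) /\
  (forall a nu, cofinal_subset a alpha -> is_card a nu -> le_ord mu nu).

Definition regular_cardinal kappa : Prop :=
  [/\ is_cardinal kappa, infinite_set (ext kappa) & is_cof kappa kappa].

Definition cof_lt kappa : set V :=
  [set alpha | is_ordinal alpha /\ exists2 mu, is_cof alpha mu & mu ∈ kappa].

Definition is_trcl x t : Prop :=
  [/\ transitive_set t, ext x `<=` ext t &
      forall s, transitive_set s -> ext x `<=` ext s -> ext t `<=` ext s].

Definition Hset theta : set V :=
  [set x | exists2 t, is_trcl x t & card_lt t theta].

(* First-order formulas in the language of set theory; variables are named by
   natural numbers. *)
Inductive fml : Type :=
| FMem of nat & nat
| FEq of nat & nat
| FNot of fml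
| FAnd of fml & fml
| FAll of nat & fml.

Definition update (v : nat -> V) (i : nat) x : nat -> V :=
  fun j => if j == i then x else v j.

Fixpoint sat A (v : nat -> V) (phi : fml) : Prop :=
  match phi with
  | FMem i j => v i ∈ v j
  | FEq i j => v i = v j
  | FNot psi => ~ sat A v psi
  | FAnd psi chi => sat A v psi /\ sat A v chi
  | FAll i psi => forall x, A x -> sat A (update v i x) psi
  end.

Definition elementary A B : Prop :=
  [/\ A !=set0, A `<=` B &
      forall (phi : fml) (v : nat -> V), (forall i, A (v i)) ->
        (sat A v phi <-> sat B v phi)].

Definition is_kappa M kappa : Prop :=
  [/\ is_ordinal kappa, kappa ∈ M, ext M `&` ext kappa <> ext kappa &
      forall alpha, is_ordinal alpha -> alpha ∈ M ->
        ext M `&` ext alpha <> ext alpha -> le_ord kappa alpha].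

Definition approximated delta M d : Prop :=
  forall Z, Z ∈ M -> card_lt Z delta -> set_in (ext d `&` ext Z) M.

Definition guessed M X d : Prop :=
  exists e, [/\ e ∈ M, ext e `<=` ext X & ext d `&` ext M = ext e `&` ext M].

Definition guessing theta delta M : Prop :=
  forall X, X ∈ M -> forall d, ext d `<=` ext X -> Hset theta d ->
    approximated delta M d -> guessed M X d.

Definition limit_point c beta : Prop :=
  limit_ordinal beta /\
  forall gamma, gamma ∈ beta -> exists2 xi, xi ∈ c & gamma ∈ xi /\ xi ∈ beta.

Definition club c alpha : Prop :=
  [/\ ext c `<=` ext alpha,
      forall beta, beta ∈ alpha -> exists2 gamma, gamma ∈ c & beta ∈ gamma &
      forall beta, beta ∈ alpha -> limit_point c beta -> beta ∈ c].

(* Only the values of C on Lim ∩ E ∩ lambda are relevant. *)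
Definition square_sequence E kappa lambda (C : V -> V) : Prop :=
  let dom alpha := [/\ limit_ordinal alpha, E alpha & alpha ∈ lambda] in
  [/\ forall alpha, dom alpha ->
        ext (C alpha) !=set0 /\ card_lt (C alpha) kappa,
      forall alpha, dom alpha -> forall c, c ∈ C alpha -> club c alpha,
      forall alpha, dom alpha -> forall c, c ∈ C alpha ->
        forall beta, limit_point c beta -> E beta ->
          set_in (ext c `&` ext beta) (C beta) &
      ~ exists D, club D lambda /\
          forall delta, limit_point D delta -> E delta -> delta ∈ lambda ->
            set_in (ext D `&` ext delta) (C delta)].

Definition square E kappa lambda : Prop :=
  exists C : V -> V, square_sequence E kappa lambda C.

End SetTheory.

(* Main.v *)
Require Import Defs.
From mathcomp Require Import all_boot.
From mathcomp Require Import boolp classical_sets functions cardinality.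

(** Suppose the square principle holds at [lambda]. Let [gamma] be the least
    limit ordinal of cofinality at least [kappa] on which some sequence as in the
    principle has no thread; by elementarity [gamma] and such a sequence are in
    [M]. Woodin's proof of Kunen's theorem, run inside [M], shows that
    [eta := sup (M ∩ gamma)] is below [gamma]. If [eta] has cofinality less than
    [kappa], let [C] be a member of the sequence at [eta]; otherwise (which is
    possible, since [M] may be large) the minimality of [gamma] provides a thread
    [C] on [eta]. Guessing shows that [eta] has uncountable cofinality and that
    [M] is [omega]-closed below [eta], so [C ∩ M] is unbounded in [eta]. Since
    initial segments of [C] at limit points in [M] belong to [M], [C] is
    approximated; a set [e ∈ M] guessing it is a thread on [gamma]. *)

Set Implicit Arguments.
Unset Strict Implicit.
Unset Printing Implicit Defensive.

Local Open Scope classical_set_scope.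
Local Open Scope card_scope.

(** * Sets and ordinals *)

Section Universe.
Variable V : zfc_universe.
Implicit Types (A : set V) (x y z a b c : V).

(** Minimality of [gamma] has a price: [gamma] need not be regular, and nothing yet prevents
    [M ∩ gamma] from being cofinal in it. Boundedness is therefore proved for every limit ordinal of
    [M] whose cofinality is not below [kappa], and the Kunen-Woodin argument is run along a thin
    cofinal set in place of all of [gamma]. The working principle about [kappa] is one equivalence:
    a set [x ∈ M] has size less than [kappa] exactly when [x] is included in [M] ([ksmall_subM],
    [subM_ksmall]). It turns the width of the sequence, small cofinalities and even countable
    ladders into statements about membership in [M]. Guessing is applied twice, to a cofinal
    omega-sequence in [not_cofw_sup] and to [C] in [thread_ex]. The guess [e] agrees with [C] on [M]
    only; each property of [e] is checked at points of [M] and carried to all of [gamma] by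
    elementarity. Since elementarity concerns formulas over [H_theta], the notions involved are
    restated with sets of [H_theta] as codes. *)

Lemma ext_inj x y : ext x = ext y -> x = y.
Proof.
move=> e; apply: zfc_extensionality => z.
by have : ext x z <-> ext y z by rewrite e.
Qed.

Lemma set_eq x y : (forall z, z ∈ x <-> z ∈ y) -> x = y.
Proof. exact: zfc_extensionality. Qed.

Lemma elem_irr x : ~ x ∈ x.
Proof.
move=> xx; have [p pE] := zfc_pairing x x.
have [|y /pE[]-> /(_ x xx)] := @zfc_foundation V p; first by exists x; apply/pE; left.
all: by apply; apply/pE; left.
Qed.

Lemma elem_asym x y : x ∈ y -> ~ y ∈ x.
Proof.
move=> xy yx; have [p pE] := zfc_pairing x y.
have [|z /pE[]->] := @zfc_foundation V p; first by exists x; apply/pE; left.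
- by move=> /(_ y yx); apply; apply/pE; right.
- by move=> /(_ x xy); apply; apply/pE; left.
Qed.

Lemma repl_ex (f : V -> V) x : {y | forall z, z ∈ y <-> exists2 i, i ∈ x & z = f i}.
Proof.
apply: cid; have [|y yE] := @zfc_replacement V x (fun i z => z = f i).
  by move=> ? ? ? _ -> ->.
by exists y.
Qed.
Definition repl f x : V := sval (repl_ex f x).
Lemma replE f x z : z ∈ repl f x <-> exists2 i, i ∈ x & z = f i.
Proof. exact: (svalP (repl_ex f x)). Qed.

Lemma mem_repl f x i : i ∈ x -> f i ∈ repl f x.
Proof. by move=> ix; apply/replE; exists i. Qed.

Lemma sep_ex x A : {y | forall z, z ∈ y <-> z ∈ x /\ A z}.
Proof.
apply: cid; have [|y yE] := @zfc_replacement V x (fun i z => z = i /\ A i).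
  by move=> ? ? ? _ [-> _] [-> _].
exists y => z; split=> [/yE[i ix [->]]//|[zx Az]]; by apply/yE; exists z.
Qed.
Definition sep x A : V := sval (sep_ex x A).
Lemma sepE x A z : z ∈ sep x A <-> z ∈ x /\ A z.
Proof. exact: (svalP (sep_ex x A)). Qed.

Definition upair x y : V := sval (cid (zfc_pairing x y)).
Lemma upairE x y z : z ∈ upair x y <-> z = x \/ z = y.
Proof. exact: (svalP (cid (zfc_pairing x y))). Qed.

Definition union x : V := sval (cid (zfc_union x)).
Lemma unionE x z : z ∈ union x <-> exists2 y, y ∈ x & z ∈ y.
Proof. exact: (svalP (cid (zfc_union x))). Qed.

Definition infty : V := sval (cid (zfc_infinity V)).
Definition emp : V := sep infty set0.
Lemma empE z : ~ z ∈ emp.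
Proof. by move=> /sepE[]. Qed.
Lemma emp_eq x : (forall z, ~ z ∈ x) -> x = emp.
Proof. by move=> h; apply: set_eq => z; split=> [/h|/empE]. Qed.

Definition adj x y : V := union (upair x (upair y y)).
Lemma adjE x y z : z ∈ adj x y <-> z ∈ x \/ z = y.
Proof.
split=> [/unionE[w /upairE[]->]|[zx|->]]; first by left.
- by move=> /upairE[]->; right.
- by apply/unionE; exists x => //; apply/upairE; left.
- by apply/unionE; exists (upair y y); apply/upairE; [right|left].
Qed.

Definition opair x y : V := upair (upair x x) (upair x y).
Lemma opair_inj x y x' y' : opair x y = opair x' y' -> x = x' /\ y = y'.
Proof.
move=> e.
have m1 z : (z = upair x x \/ z = upair x y) <-> (z = upair x' x' \/ z = upair x' y').
  by rewrite -!upairE -/(opair x y) e.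
have up a b c d : upair a b = upair c d -> forall z, (z = a \/ z = b) <-> (z = c \/ z = d).
  by move=> h z; rewrite -!upairE h.
have xx' : x = x'.
  have [/(_ (or_introl erefl))[]h _] := m1 (upair x x).
    by have [_ /(_ (or_introl erefl))[]->] := up _ _ _ _ h x'.
  by have [_ /(_ (or_introl erefl))[]->] := up _ _ _ _ h x'.
subst x'; split=> //.
have [/(_ (or_intror erefl))[]h _] := m1 (upair x y).
  have [/(_ (or_intror erefl))yx _] := up _ _ _ _ h y.
  have {}yx : y = x by case: yx.
  subst y; have [_ /(_ (or_intror erefl))[]h'] := m1 (upair x y').
    by have [/(_ (or_intror erefl))[]->] := up _ _ _ _ h' y'.
  by have [/(_ (or_intror erefl))[]->] := up _ _ _ _ h' y'.
have [/(_ (or_intror erefl))[]// yx _] := up _ _ _ _ h y.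
by have [_ /(_ (or_intror erefl))[]->] := up _ _ _ _ h y'.
Qed.

Fixpoint num n : V := if n is n'.+1 then adj (num n') (num n') else emp.

Lemma numE n z : z ∈ num n <-> exists2 m, m < n & z = num m.
Proof.
elim: n z => [|n IH] z /=; first by split=> [/empE//|[]].
rewrite adjE; split=> [[/IH[m mn ->]|->]|[m]].
- by exists m => //; apply: ltnW.
- by exists n.
- by rewrite ltnS leq_eqVlt => /predU1P[-> ->|mn ->]; [right|left; apply/IH; exists m].
Qed.

Lemma num_inj : injective num.
Proof.
move=> m n e; case: (ltngtP m n) => // h.
  by case: (@elem_irr (num n)); rewrite -{1}e; apply/numE; exists m.
by case: (@elem_irr (num m)); rewrite {1}e; apply/numE; exists n.
Qed.

Lemma num_infty n : num n ∈ infty.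
Proof.
have [[e ew eE] h] := svalP (cid (zfc_infinity V)); rewrite -/infty in ew h.
elim: n => [|n IH] /=; first by rewrite -(emp_eq eE).
have [s sw sE] := h _ IH; suff <- : s = adj (num n) (num n) by [].
by apply: set_eq => z; rewrite adjE.
Qed.

(** [infty] may have members besides the numerals; the relation given to replacement relates them to
    nothing, so omega need not be cut out. *)
Lemma nrange_ex (s : nat -> V) : {r | forall z, z ∈ r <-> exists n, z = s n}.
Proof.
apply: cid.
have [|r rE] := @zfc_replacement V infty (fun y z => exists2 n, y = num n & z = s n).
  by move=> x y y' _ [n -> ->] [m /num_inj -> ->].
exists r => z; split=> [/rE[y _ [n _ ->]]|[n ->]]; first by exists n.
by apply/rE; exists (num n); [exact: num_infty|exists n].
Qed.
Definition nrange s : V := sval (nrange_ex s).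
Lemma nrangeE s z : z ∈ nrange s <-> exists n, z = s n.
Proof. exact: (svalP (nrange_ex s)). Qed.

Definition trc x : V := union (nrange (fun n => iter n union x)).

Lemma trcE x z : z ∈ trc x <-> exists n, z ∈ iter n union x.
Proof.
split=> [/unionE[y /nrangeE[n ->]]|[n zn]]; first by exists n.
by apply/unionE; exists (iter n union x) => //; apply/nrangeE; exists n.
Qed.

Lemma trc_trans x : transitive_set (trc x).
Proof.
move=> y /trcE[n yn] z zy; apply/trcE; exists n.+1; apply/unionE; by exists y.
Qed.

Lemma trc_sub x : ext x `<=` ext (trc x).
Proof. by move=> z zx; apply/trcE; exists 0. Qed.

Lemma trc_min x s : transitive_set s -> ext x `<=` ext s -> ext (trc x) `<=` ext s.
Proof.
move=> ts xs z /trcE[n]; elim: n z => [|n IH] z; first exact: xs.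
by move=> /unionE[y /IH ys zy]; apply: ts zy.
Qed.

Lemma is_trclP x t : is_trcl x t <-> t = trc x.
Proof.
split=> [[tt xt tmin]|->]; last by split; [exact: trc_trans|exact: trc_sub|exact: trc_min].
apply: ext_inj; rewrite eqEsubset; split.
  by apply: tmin; [exact: trc_trans|exact: trc_sub].
exact: trc_min.
Qed.

(** Foundation speaks of sets only. The inaccessible points form a set once they are taken inside
    the transitive closure of {x}; this yields induction and [Fix] along membership. *)
Lemma elem_wf : well_founded (@elem V).
Proof.
move=> x; apply: contrapT => nx.
set t := trc (upair x x); set B := sep t (fun y => ~ Acc (@elem V) y).
have xt : x ∈ t by apply: trc_sub; apply/upairE; left.
have [|y /sepE[yt ny] ymin] := @zfc_foundation V B; first by exists x; apply/sepE.
apply: ny; constructor => z zy; apply: contrapT => nz; apply: (ymin z zy).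
by apply/sepE; split=> //; apply: trc_trans zy.
Qed.

Lemma elem_ind (P : V -> Prop) : (forall x, (forall y, y ∈ x -> P y) -> P x) -> forall x, P x.
Proof. by move=> h x; elim: (elem_wf x) => {}x _; apply: h. Qed.

Implicit Types alpha beta gamma : V.

Lemma ord_elem alpha beta : is_ordinal alpha -> beta ∈ alpha -> is_ordinal beta.
Proof.
move=> [ta oa] ba; split=> [y yb z zy|y z yb zb]; last first.
  by apply: oa; apply: ta ba _ _.
have ya := ta _ ba _ yb; have za := ta _ ya _ zy.
case: (oa _ _ za ba) => // [zb|bz].
  by subst z; case: (elem_asym zy yb).
(* The cycle z ∈ y ∈ beta ∈ z contradicts foundation at {y, z, beta}. *)
exfalso; move: zy yb bz; clear.
move=> zy yb bz; have [p pE] := zfc_pairing y z.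
pose q := adj p beta.
have [|w /adjE[/pE[]|]->] := @zfc_foundation V q.
- by exists beta; apply/adjE; right.
- by move=> /(_ z zy); apply; apply/adjE; left; apply/pE; right.
- by move=> /(_ beta bz); apply; apply/adjE; right.
- by move=> /(_ y yb); apply; apply/adjE; left; apply/pE; left.
Qed.

Lemma ord_trans alpha x y : is_ordinal alpha -> x ∈ y -> y ∈ alpha -> x ∈ alpha.
Proof. by move=> [ta _] xy ya; apply: ta ya _ xy. Qed.

Lemma ord_total alpha beta : is_ordinal alpha -> is_ordinal beta ->
  [\/ alpha ∈ beta, alpha = beta | beta ∈ alpha].
Proof.
elim/elem_ind: alpha beta => a IHa; elim/elem_ind => b IHb oa ob.
case: (pselect (b ∈ a)) => ba; first by apply: Or33.
case: (pselect (a ∈ b)) => ab; first by apply: Or31.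
apply: Or32; apply: set_eq => z; split=> [za|zb].
  have oz := ord_elem oa za.
  case: (IHa z za b oz ob) => // [zb|bz]; first by subst z.
  by case: ba; apply: ord_trans bz za.
have oz := ord_elem ob zb.
case: (IHb z zb oa oz) => // [az|az]; last by subst z.
by case: ab; apply: ord_trans az zb.
Qed.

Lemma ord_leP alpha beta : is_ordinal alpha -> is_ordinal beta ->
  ~ alpha ∈ beta -> le_ord beta alpha.
Proof. by move=> oa ob nab; case: (ord_total oa ob) => // h; [right|left]. Qed.

Lemma ord_le_lt alpha beta gamma : is_ordinal gamma ->
  le_ord alpha beta -> beta ∈ gamma -> alpha ∈ gamma.
Proof. by move=> og [ab|->] // bg; apply: ord_trans ab bg. Qed.

Lemma ord_lt_le alpha beta gamma : is_ordinal gamma ->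
  alpha ∈ beta -> le_ord beta gamma -> alpha ∈ gamma.
Proof. by move=> og ab [bg|<-] //; apply: ord_trans ab bg. Qed.

Lemma ord_le_sub alpha beta : is_ordinal beta -> le_ord alpha beta ->
  ext alpha `<=` ext beta.
Proof. by move=> ob ab z za; apply: ord_lt_le za ab. Qed.

Lemma ord_sub_le alpha beta : is_ordinal alpha -> is_ordinal beta ->
  ext alpha `<=` ext beta -> le_ord alpha beta.
Proof. by move=> oa ob ab; apply: ord_leP => // /ab /elem_irr. Qed.

Lemma ord_least A : (exists2 a, is_ordinal a & A a) ->
  exists a, [/\ is_ordinal a, A a & forall b, b ∈ a -> ~ A b].
Proof.
move=> [a oa Aa]; elim/elem_ind: a oa Aa => a IH oa Aa.
case: (pselect (exists2 b, b ∈ a & A b)) => [[b ba Ab]|nb].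
  by apply: (IH b) => //; apply: ord_elem ba.
by exists a; split=> // b ba Ab; apply: nb; exists b.
Qed.

Lemma ord_succ alpha : is_ordinal alpha -> is_ordinal (adj alpha alpha).
Proof.
move=> oa; split=> [y /adjE[ya z zy|->z za]|y z].
- by apply/adjE; left; apply: ord_trans ya.
- by apply/adjE; left.
- move=> /adjE ya /adjE za; apply: ord_total.
    by case: ya => [|->//]; apply: ord_elem.
  by case: za => [|->//]; apply: ord_elem.
Qed.

Lemma ord_union x : (forall a, a ∈ x -> is_ordinal a) -> is_ordinal (union x).
Proof.
move=> ox; split=> [y /unionE[a ax ya] z zy|y z /unionE[a ax ya] /unionE[b bx zb]].
  by apply/unionE; exists a => //; apply: ord_trans (ox _ ax) zy ya.
by apply: ord_total; [apply: ord_elem ya|apply: ord_elem zb]; apply: ox.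
Qed.

Lemma lim_ord alpha : limit_ordinal alpha -> is_ordinal alpha.
Proof. by case. Qed.

Lemma lim_succ alpha x : limit_ordinal alpha -> x ∈ alpha -> adj x x ∈ alpha.
Proof.
move=> [oa _ la] xa; have [y ya xy] := la _ xa.
have oy := ord_elem oa ya.
apply: ord_le_lt ya => //; apply: ord_sub_le => //.
  exact/ord_succ/(ord_elem oa).
by move=> z /adjE[zx|->//]; apply: ord_trans zx xy.
Qed.

(** Literally the second half of [limit_point]; [a] may have members outside [beta]. *)
Definition unb a beta : Prop := forall x, x ∈ beta -> exists2 y, y ∈ a & x ∈ y /\ y ∈ beta.

(** The case split for inductions along initial segments of a set of ordinals: the first two cases
    are finite steps, the third produces a limit point. *)
Lemma sup_cases a : (forall x, x ∈ a -> is_ordinal x) ->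
  [\/ a = emp, exists2 m, m ∈ a & forall x, x ∈ a -> le_ord x m |
      limit_ordinal (union a) /\ unb a (union a) /\ ext a `<=` ext (union a)].
Proof.
move=> oa; case: (pselect (exists2 m, m ∈ a & forall x, x ∈ a -> le_ord x m)) => nm.
  exact: Or32.
have nm' x : x ∈ a -> exists2 y, y ∈ a & x ∈ y.
  move=> xa; apply: contrapT => h; apply: nm; exists x => // y ya.
  by apply: ord_leP => [||xy]; [exact: oa|exact: oa|apply: h; exists y].
have sub : ext a `<=` ext (union a).
  by move=> x /nm'[y ya xy]; apply/unionE; exists y.
case: (pselect (a = emp)) => [|ne]; first exact: Or31.
apply: Or33; split; last split=> //.
  split; first exact: ord_union.
    apply: contrapT => h; apply: ne; apply: emp_eq => z /sub zu; apply: h; by exists z.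
  by move=> b /unionE[y /sub yu yb]; exists y.
by move=> x /unionE[y ya xy]; exists y => //; split=> //; apply: sub.
Qed.

Lemma limit_point_mono a b beta : limit_point a beta ->
  (forall x, x ∈ a -> x ∈ beta -> x ∈ b) -> limit_point b beta.
Proof.
move=> [lb ub] h; split=> // x xb; have [y ya [xy yb]] := ub _ xb.
by exists y => //; apply: h.
Qed.

End Universe.

(** * Cardinals and [Hset theta] *)

Section Cardinals.
Variable V : zfc_universe.
Implicit Types (A : set V) (x y z a b c : V).
Implicit Types alpha beta gamma mu nu theta : V.

Lemma card_le_inj x y : ext x #<= ext y -> exists f : V -> V,
  (forall z, z ∈ x -> f z ∈ y) /\
  (forall z z', z ∈ x -> z' ∈ x -> f z = f z' -> z = z').
Proof.
move=> /card_leP[f].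
exists (fun z => if pselect (z ∈ x) is left h then set_val (f (SigSub (mem_set (h : ext x z)))) else z).
split=> [z zx|z z' zx z'x].
  by case: pselect => // h; exact: (set_valP (f _)).
case: pselect => // h; case: pselect => // h' /val_inj.
by move=> /(@inj _ _ _ f); rewrite !in_setT => /(_ isT isT)[].
Qed.

Lemma card_le_enum x y : ext x #<= ext y -> exists g : V -> V,
  forall z, z ∈ x -> exists2 i, i ∈ y & g i = z.
Proof.
move=> /card_le_inj[f [fy fI]].
exists (fun i => if pselect (exists2 z, z ∈ x & f z = i) is left h then sval (cid2 h) else i).
move=> z zx; exists (f z); first exact: fy.
case: pselect => [h|[]]; last by exists z.
by case: cid2 => z' /= z'x /fI; apply.
Qed.

Lemma enum_card_le x y (g : V -> V) :
  (forall z, z ∈ x -> exists2 i, i ∈ y & g i = z) -> ext x #<= ext y.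
Proof.
move=> h; apply: (@card_le_trans _ _ _ (g @` ext y)); last exact: card_image_le.
by apply: subset_card_le => z /h[i iy <-]; exists i.
Qed.

Lemma inj_ext_card_le x y (f : V -> V) : (forall z, z ∈ x -> f z ∈ y) ->
  (forall z z', z ∈ x -> z' ∈ x -> f z = f z' -> z = z') -> ext x #<= ext y.
Proof.
move=> fy fI; apply: (@card_le_trans _ _ _ (f @` ext x)).
  have /card_eqPle[] : f @` ext x #= ext x; last by [].
  by apply: inj_card_eq => z z' /set_mem zx /set_mem z'x; apply: fI.
by apply: subset_card_le => _ [z /fy ? <-].
Qed.

Lemma card_eq_ord x : exists2 alpha : V, is_ordinal alpha & ext x #= ext alpha.
Proof.
(* The default [x] is not a member of [x], so [F a ∈ x] says that the recursion has not yet stopped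
   at [a]. *)
pose pick (P : set V) := if pselect (P !=set0) is left h then sval (cid h) else x.
have pickP P : P !=set0 -> P (pick P).
  by rewrite /pick; case: pselect => // h _; case: cid.
pose step a (rec : forall b, b ∈ a -> V) :=
  pick [set z | z ∈ x /\ forall b (h : b ∈ a), z <> rec b h].
pose F := Fix (@elem_wf V) (fun _ => V) step.
have FE a : F a = pick [set z | z ∈ x /\ forall b, b ∈ a -> z <> F b].
  rewrite /F Fix_eq // => {}a f g fg; congr step.
  by apply: functional_extensionality_dep => b; apply: functional_extensionality_dep => h.
have F1 a : F a ∈ x -> forall b, b ∈ a -> F a <> F b.
  rewrite FE; set P := [set z | _]; case: (pselect (P !=set0)) => [/pickP[//]|n].
  by rewrite {1}/pick; case: pselect => // _ /elem_irr.
have F2 a : ~ F a ∈ x -> forall z, z ∈ x -> exists2 b, b ∈ a & F b = z.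
  rewrite FE; set P := [set z | _]; case: (pselect (P !=set0)) => [/pickP[//]|n _ z zx].
  apply: contrapT => h; apply: n; exists z; split=> // b ba e; apply: h; by exists b.
have [a [oa na am]] : exists a, [/\ is_ordinal a, ~ F a ∈ x & forall b, b ∈ a -> ~ ~ F b ∈ x].
  apply: ord_least; apply: contrapT => h.
  have {}h a : is_ordinal a -> F a ∈ x.
    by move=> oa; apply: contrapT => nF; apply: h; exists a.
  have FI a b : is_ordinal a -> is_ordinal b -> F a = F b -> a = b.
    by move=> oa ob e; case: (ord_total oa ob) => // ab; [case: (F1 b (h b ob) a)|case: (F1 a (h a oa) b)].
  (* Inverting [F] by replacement would collect all ordinals in a set, which would then be an
     ordinal and a member of itself. *)
  have [|O OE] := @zfc_replacement V x (fun z a => is_ordinal a /\ z = F a).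
    by move=> z a b _ [oa ->] [ob]; apply: FI.
  have {}OE a : a ∈ O <-> is_ordinal a.
    by rewrite OE; split=> [[z _ []//]|oa]; exists (F a); [apply: h|].
  apply: (@elem_irr V O); apply/OE; split=> [y /OE oy z zy|y z /OE oy /OE oz].
    by apply/OE; apply: ord_elem zy.
  exact: ord_total.
have {}am b : b ∈ a -> F b ∈ x by move=> /am /contrapT.
exists a => //; apply/card_esym; apply/card_eqPle; split.
  apply: (inj_ext_card_le (f := F)) => // b c ba ca e.
  have ob := ord_elem oa ba; have oc := ord_elem oa ca.
  by case: (ord_total ob oc) => // bc; [case: (F1 c (am c ca) b)|case: (F1 b (am b ba) c)].
by apply: enum_card_le (F2 a na).
Qed.

Lemma is_card_ex x : exists mu : V, is_card x mu.
Proof.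
have [a oa xa] := card_eq_ord x.
have [|mu [omu xmu mmin]] := @ord_least V (fun a => ext x #= ext a); first by exists a.
exists mu; split=> //; split=> // b bmu bE; apply: (mmin b bmu).
by apply: card_eq_trans xmu _; apply: card_esym.
Qed.

Lemma is_card_le x mu nu : is_card x mu -> is_ordinal nu ->
  ext x #<= ext nu -> le_ord mu nu.
Proof.
move=> [[omu cmu] xmu] onu xnu; apply: ord_leP => // numu.
apply: (cmu nu numu); apply/card_eqPle; split.
  by apply: subset_card_le => z zn; apply: ord_trans zn numu.
by apply: card_le_trans xnu; case/card_eqPle: xmu.
Qed.

Lemma card_ltP x theta : is_ordinal theta ->
  card_lt x theta <-> exists2 nu, nu ∈ theta & ext x #<= ext nu.
Proof.
move=> ot; split=> [[mu [_ /card_eqPle[xm _]] mt]|[nu nt xnu]]; first by exists mu.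
have [mu xmu] := is_card_ex x; exists mu => //.
exact: ord_le_lt ot (is_card_le xmu (ord_elem ot nt) xnu) nt.
Qed.

Lemma card_lt_mono x y theta : is_ordinal theta -> ext x #<= ext y ->
  card_lt y theta -> card_lt x theta.
Proof.
move=> ot xy /(card_ltP _ ot)[nu nt ynu]; apply/(card_ltP _ ot); exists nu => //.
exact: card_le_trans xy ynu.
Qed.

Section Regular.
Variable theta : V.
Hypothesis theta_regular : regular_cardinal theta.

Lemma reg_ord : is_ordinal theta.
Proof. by case: theta_regular => -[]. Qed.
Let ot := reg_ord.

Lemma finite_card_lt x : finite_set (ext x) -> card_lt x theta.
Proof.
move=> fx; have [mu xmu] := is_card_ex x; exists mu => //.
apply: contrapT => nmu; have [_ inf _] := theta_regular; apply: inf.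
have [[omu _] /card_eqPle[_ mux]] := xmu.
apply: card_le_finite fx; apply: card_le_trans mux.
by apply: subset_card_le; apply: ord_le_sub => //; apply: ord_leP.
Qed.

Lemma bounded_card_lt a : ext a `<=` ext theta -> card_lt a theta ->
  exists2 b, b ∈ theta & ext a `<=` ext b.
Proof.
move=> at_ [nu anu nut]; have [_ _ [_ ct]] := theta_regular.
apply: contrapT => h; have : le_ord theta nu.
  apply: ct anu; split=> // b bt; apply: contrapT => hb; apply: h.
  exists b => // z za; have oz := ord_elem ot (at_ _ za); have ob := ord_elem ot bt.
  apply: contrapT => zb; apply: hb; exists z => //; exact: ord_leP.
by move=> tn; apply: (@elem_irr V nu); apply: ord_lt_le tn => //; case: anu => -[].
Qed.

(** Regularity replaces cardinal multiplication. If [theta] injected into [u] by [h], each pullback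
    [S i] would be bounded by some [bb i], and these bounds by a single [b]; but [h b] lies in some
    [B i], so [b] is below [bb i]. *)
Lemma bigunion_card_lt u y (B : V -> set V) :
  card_lt y theta ->
  (forall i, i ∈ y -> exists2 s, card_lt s theta & B i `<=` ext s) ->
  (forall z, z ∈ u -> exists2 i, i ∈ y & B i z) -> card_lt u theta.
Proof.
move=> yt Bt uB; have [mu umu] := is_card_ex u; exists mu => //.
apply: contrapT => nmu; have [[omu _] /card_eqPle[_ muu]] := umu.
have /card_le_inj[h [hu hI]] : ext theta #<= ext u.
  apply: card_le_trans muu; apply: subset_card_le.
  by apply: ord_le_sub => //; apply: ord_leP.
pose S i := sep theta (fun t => B i (h t)).
have bS i : i ∈ y -> exists2 b, b ∈ theta & ext (S i) `<=` ext b.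
  move=> iy; apply: bounded_card_lt => [z /sepE[]//|].
  have [s st Bs] := Bt _ iy; apply: card_lt_mono st => //.
  apply: (inj_ext_card_le (f := h)) => [z /sepE[_ /Bs]//|z z' /sepE[zt _] /sepE[z't _]].
  exact: hI.
pose bb i := if pselect (i ∈ y) is left k then sval (cid2 (bS i k)) else i.
have bbP i : i ∈ y -> bb i ∈ theta /\ ext (S i) `<=` ext (bb i).
  by move=> iy; rewrite /bb; case: pselect => // k; case: cid2.
have [b bt bE] : exists2 b, b ∈ theta & ext (repl bb y) `<=` ext b.
  apply: bounded_card_lt => [z /replE[i iy ->]|]; first by have [] := bbP _ iy.
  apply: card_lt_mono yt => //; apply: (enum_card_le (g := bb)) => z /replE[i iy ->].
  by exists i.
have [i iy Bi] := uB _ (hu _ bt).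
have bS' : b ∈ S i by apply/sepE.
have [_ /(_ _ bS') /= h1] := bbP _ iy.
by apply: (elem_asym h1); apply: bE; apply: mem_repl.
Qed.

Local Notation H := (Hset theta).

Lemma HP x : H x <-> card_lt (trc x) theta.
Proof.
split=> [[t /is_trclP-> //]|h]; by exists (trc x) => //; apply/is_trclP.
Qed.

Lemma H_intro x t : transitive_set t -> ext x `<=` ext t -> card_lt t theta -> H x.
Proof.
move=> tt xt ct; apply/HP; apply: card_lt_mono ct => //.
by apply: subset_card_le; apply: trc_min.
Qed.

Lemma H_sub x y : H y -> ext x `<=` ext y -> H x.
Proof.
move=> /HP cy xy; apply: H_intro cy; first exact: trc_trans.
by move=> z /xy; apply: trc_sub.
Qed.

Lemma H_trans x y : H y -> x ∈ y -> H x.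
Proof.
move=> /HP cy xy; apply: H_intro cy; first exact: trc_trans.
by apply: trc_trans; apply: trc_sub.
Qed.

Lemma H_ord alpha : alpha ∈ theta -> H alpha.
Proof.
move=> at_; have [tt _] := ord_elem ot at_; apply: (H_intro tt) => //.
by apply/card_ltP => //; exists alpha.
Qed.

Lemma H_card x : H x -> card_lt x theta.
Proof.
move=> /HP; apply: card_lt_mono => //; apply: subset_card_le; exact: trc_sub.
Qed.

Lemma H_union x : H x -> H (union x).
Proof.
move=> /HP cx; apply: H_intro cx; first exact: trc_trans.
by move=> z /unionE[y yx zy]; apply: trc_trans zy; apply: trc_sub.
Qed.

Lemma upair_card_lt x y : card_lt (upair x y) theta.
Proof.
apply: finite_card_lt; apply: (@sub_finite_set _ _ [set x; y]); last exact: finite_set2.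
by move=> z /upairE.
Qed.

Lemma card_lt_adj x y : card_lt x theta -> card_lt (adj x y) theta.
Proof.
move=> cx; apply: (@bigunion_card_lt _ (upair x (upair y y)) (@ext V)) => //.
- exact: upair_card_lt.
- move=> i /upairE[]->; first by exists x.
  by exists (upair y y) => //; exact: upair_card_lt.
- by move=> z /unionE[i iu zi]; exists i.
Qed.

Lemma H_all x : card_lt x theta -> (forall z, z ∈ x -> H z) -> H x.
Proof.
move=> cx Hx; pose g z := adj (trc z) z.
apply: (@H_intro _ (union (repl g x))).
- move=> y /unionE[_ /replE[z zx ->] /adjE yz] w wy.
  apply/unionE; exists (g z); first exact: mem_repl.
  apply/adjE; left; case: yz => [yz|e]; first by apply: trc_trans wy.
  by subst y; apply: trc_sub.
- move=> z zx; apply/unionE; exists (g z); first exact: mem_repl.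
  by apply/adjE; right.
- apply: (@bigunion_card_lt _ x (fun i => ext (g i))) => //.
    by move=> i /Hx/HP ci; exists (g i) => //; apply: card_lt_adj.
  by move=> z /unionE[_ /replE[i ix ->] zi]; exists i.
Qed.

Lemma H_upair x y : H x -> H y -> H (upair x y).
Proof. by move=> Hx Hy; apply: H_all => [|z /upairE[]->]; first exact: upair_card_lt. Qed.

Lemma H_opair x y : H x -> H y -> H (opair x y).
Proof. by move=> Hx Hy; do 2 ?apply: H_upair. Qed.

Lemma H_adj x y : H x -> H y -> H (adj x y).
Proof. by move=> Hx Hy; apply: H_union; do 2 ?apply: H_upair. Qed.

Lemma H_sep x A : H x -> H (sep x A).
Proof. by move=> Hx; apply: H_sub Hx _ => z /sepE[]. Qed.

Lemma H_repl (f : V -> V) x : H x -> (forall z, z ∈ x -> H (f z)) -> H (repl f x).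
Proof.
move=> Hx Hf; apply: H_all => [|z /replE[i ix ->]]; last exact: Hf.
apply: card_lt_mono (H_card Hx) => //; apply: (enum_card_le (g := f)) => z /replE[i ix ->].
by exists i.
Qed.

Lemma H_emp : H (emp V).
Proof. by apply: H_all => [|z /empE//]; apply: finite_card_lt; apply: (@sub_finite_set _ _ set0) => // z /empE. Qed.

End Regular.
End Cardinals.

(** * Definability *)

Section Definability.
Variable V : zfc_universe.
Implicit Types (x y z : V) (v w : nat -> V).

(** Unlike [fml], these formulas have parameters and de Bruijn indices, so that the binders of a
    statement can be followed without choosing variable names. *)
Inductive term := Var of nat | Cst of V.
Inductive form :=
| DMem of term & term
| DEq of term & term
| DNot of form
| DAnd of form & form
| DAll of form.

Definition scons x v : nat -> V := fun n => if n is n'.+1 then v n' else x.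
Definition teval v t := match t with Var i => v i | Cst c => c end.

Fixpoint deval (A : set V) v (phi : form) : Prop :=
  match phi with
  | DMem s t => teval v s ∈ teval v t
  | DEq s t => teval v s = teval v t
  | DNot p => ~ deval A v p
  | DAnd p q => deval A v p /\ deval A v q
  | DAll p => forall x, A x -> deval A (scons x v) p
  end.

Definition tsub (cs : seq V) k t : Prop :=
  match t with Var i => i < k | Cst c => exists2 n, n < size cs & nth (emp V) cs n = c end.
Fixpoint fsub (cs : seq V) k phi : Prop :=
  match phi with
  | DMem s t | DEq s t => tsub cs k s /\ tsub cs k t
  | DNot p => fsub cs k p
  | DAnd p q => fsub cs k p /\ fsub cs k q
  | DAll p => fsub cs k.+1 p
  end.

(* Constants are sent to the first variables and de Bruijn indices to levels,
   which need no renaming under quantifiers. *)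
Lemma compile cs k phi : fsub cs k phi -> exists psi : fml, forall A v w,
  (forall n, n < size cs -> w n = nth (emp V) cs n) ->
  (forall i, i < k -> w (size cs + (k - i.+1)) = v i) ->
  (deval A v phi <-> sat A w psi).
Proof.
have T (t : term) l : tsub cs l t -> exists n, forall v w,
    (forall n, n < size cs -> w n = nth (emp V) cs n) ->
    (forall i, i < l -> w (size cs + (l - i.+1)) = v i) -> w n = teval v t.
  case: t => [i|c] /=; first by move=> il; exists (size cs + (l - i.+1)) => v w _; apply.
  by move=> [n ns <-]; exists n => v w /(_ n ns).
elim: phi k => /= [s t|s t|p IH|p IHp q IHq|p IH] k.
- move=> [/T[i iE] /T[j jE]]; exists (FMem i j) => A v w hc hv /=.
  by rewrite (iE v w) // (jE v w).
- move=> [/T[i iE] /T[j jE]]; exists (FEq i j) => A v w hc hv /=.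
  by rewrite (iE v w) // (jE v w).
- by move=> /IH[psi h]; exists (FNot psi) => A v w hc hv /=; rewrite (h A v w).
- move=> [/IHp[psi h] /IHq[psi' h']]; exists (FAnd psi psi') => A v w hc hv /=.
  by rewrite (h A v w) // (h' A v w).
- move=> /IH[psi h]; exists (FAll (size cs + k) psi) => A v w hc hv /=.
  suff E x : deval A (scons x v) p <-> sat A (update w (size cs + k) x) psi.
    by split=> a x Ax; apply/E; apply: a.
  apply: h => [n ns|[|i] ik]; rewrite /update /=.
  + by rewrite hc // ltn_eqF // (leq_trans ns) // leq_addr.
  + by rewrite subn1 eqxx.
  + rewrite subSS hv // eqn_add2l ltn_eqF //.
    by rewrite ltn_subrL /= (leq_ltn_trans (leq0n i)).
Qed.

Variables (H M : set V).
Hypothesis HT : forall x y, H y -> x ∈ y -> H x.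
Hypothesis MH : elementary M H.

Lemma MsubH x : M x -> H x.
Proof. by case: MH => _ h _; apply: h. Qed.

Definition tM t := if t is Cst c then M c else True.
Fixpoint fM phi : Prop :=
  match phi with
  | DMem s t | DEq s t => tM s /\ tM t
  | DNot p => fM p
  | DAnd p q => fM p /\ fM q
  | DAll p => fM p
  end.

Lemma fsub_ex phi : fM phi -> exists cs k, (forall n, n < size cs -> M (nth (emp V) cs n)) /\
  fsub cs k phi.
Proof.
have [[m0 Mm0] _ _] := MH.
have Tm cs cs' ds k l t : tsub cs k t -> k <= l -> tsub (cs' ++ cs ++ ds) l t.
  case: t => [i|c] /=; first exact: leq_trans.
  move=> [n ns nE] _; exists (size cs' + n).
    by rewrite !size_cat ltn_add2l ltn_addr.
  by rewrite nth_cat ltnNge leq_addr /= addKn nth_cat ns.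
have Fm cs cs' ds k l phi' : fsub cs k phi' -> k <= l -> fsub (cs' ++ cs ++ ds) l phi'.
  elim: phi' k l => /= [s t|s t|p IH|p IHp q IHq|p IH] k l.
  + by move=> [a b] kl; split; apply: Tm kl.
  + by move=> [a b] kl; split; apply: Tm kl.
  + exact: IH.
  + by move=> [a b] kl; split; [apply: IHp kl|apply: IHq kl].
  + by move=> a kl; apply: (IH k.+1).
have T2 s t : tM s -> tM t -> exists cs k, (forall n, n < size cs -> M (nth (emp V) cs n)) /\
    (tsub cs k s /\ tsub cs k t).
  (* A variable is given the dummy parameter [m0], so that every term contributes exactly one
     constant. *)
  have T1 (u : term) : tM u -> exists2 c, M c & forall cs k, (exists2 n, n < size cs & nth (emp V) cs n = c) ->
      (if u is Var i then i else 0) < k -> tsub cs k u.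
    by case: u => [i|c] /= Mc; [exists m0|exists c].
  move=> /T1[c Mc hc] /T1[d Md hd].
  exists [:: c; d], (maxn (if s is Var i then i else 0) (if t is Var i then i else 0)).+1.
  split; first by move=> [|[|n]].
  split; [apply: hc|apply: hd]; rewrite ?ltnS ?leq_maxl ?leq_maxr //.
    by exists 0.
  by exists 1.
elim: phi => /= [s t|s t|p IH|p IHp q IHq|p IH].
- by move=> [a b]; apply: T2.
- by move=> [a b]; apply: T2.
- exact: IH.
- move=> [/IHp[cs [k [Mcs a]]] /IHq[ds [l [Mds b]]]].
  exists (cs ++ ds), (maxn k l); split.
    move=> n; rewrite size_cat nth_cat => hn; case: ltnP => [|h1]; first exact: Mcs.
    by apply: Mds; rewrite ltn_subLR.
  split; first by apply: (Fm _ [::] ds _ _ _ a); apply: leq_maxl.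
  by rewrite -[ds]cats0; apply: (Fm _ cs [::] _ _ _ b); apply: leq_maxr.
- move=> /IH[cs [k [Mcs a]]]; exists cs, k; split=> //.
  by have := Fm _ [::] [::] _ k.+1 _ a; rewrite cats0; apply.
Qed.

Lemma deval_elem phi v : fM phi -> (forall i, M (v i)) -> deval M v phi <-> deval H v phi.
Proof.
move=> /fsub_ex[cs [k [Mcs /compile[psi h]]]] Mv.
(* After the constants come the values of [v] in reverse, as [compile] puts index [i] at level
   [k - i.+1]; truncated subtraction keeps all later values in [M]. *)
pose w n := if n < size cs then nth (emp V) cs n else v (k - (n - size cs).+1).
have Mw i : M (w i) by rewrite /w; case: ifP => h1; [exact: Mcs|exact: Mv].
have E A : deval A v phi <-> sat A w psi.
  apply: h => [n ns|i ik]; first by rewrite /w ns.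
  rewrite /w ltnNge leq_addr /= addKn; congr v.
  by rewrite subnSK // subKn // ltnW.
by rewrite !E; case: MH => _ _; apply.
Qed.

(** Definability over [H] with parameters from [M], stated semantically: closure under connectives
    and quantifiers then lets [dfn] read off the formula from the shape of the statement. *)
Definition Dfn (P : (nat -> V) -> Prop) := exists2 phi, fM phi &
  forall v, (forall i, H (v i)) -> (P v <-> deval H v phi).

Definition trm (s : (nat -> V) -> V) := (exists i, s = fun v => v i) \/ (exists2 c, M c & s = fun _ => c).

Lemma trm_var i : trm (fun v => v i). Proof. by left; exists i. Qed.
Lemma trm_cst c : M c -> trm (fun _ => c). Proof. by right; exists c. Qed.
Lemma trm_shift s : trm s -> trm (fun v => s (fun n => v n.+1)).
Proof. by case=> [[i ->]|[c Mc ->]]; [left; exists i.+1|right; exists c]. Qed.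

Lemma trmP s : trm s -> exists2 t, tM t & forall v, s v = teval v t.
Proof. by case=> [[i ->]|[c Mc ->]]; [exists (Var i)|exists (Cst c)]. Qed.

Lemma trmH s v : trm s -> (forall i, H (v i)) -> H (s v).
Proof. by case=> [[i ->]//|[c Mc ->] _]; apply: MsubH. Qed.

Lemma Dfn_mem s t : trm s -> trm t -> Dfn (fun v => s v ∈ t v).
Proof.
by move=> /trmP[s' Ms sE] /trmP[t' Mt tE]; exists (DMem s' t') => // v _ /=; rewrite sE tE.
Qed.
Lemma Dfn_eq s t : trm s -> trm t -> Dfn (fun v => s v = t v).
Proof.
by move=> /trmP[s' Ms sE] /trmP[t' Mt tE]; exists (DEq s' t') => // v _ /=; rewrite sE tE.
Qed.
Lemma Dfn_iff P Q : Dfn P -> (forall v, (forall i, H (v i)) -> (Q v <-> P v)) -> Dfn Q.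
Proof. by move=> [p Mp h] PQ; exists p => // v Hv; rewrite PQ // h. Qed.
Lemma Dfn_not P : Dfn P -> Dfn (fun v => ~ P v).
Proof. by move=> [p Mp h]; exists (DNot p) => // v Hv /=; rewrite (h v). Qed.
Lemma Dfn_and P Q : Dfn P -> Dfn Q -> Dfn (fun v => P v /\ Q v).
Proof. by move=> [p Mp h] [q Mq h']; exists (DAnd p q) => // v Hv /=; rewrite (h v) // (h' v). Qed.
Lemma Dfn_or P Q : Dfn P -> Dfn Q -> Dfn (fun v => P v \/ Q v).
Proof.
move=> /Dfn_not p /Dfn_not q; apply: (Dfn_iff (Dfn_not (Dfn_and p q))) => v _.
by split=> [[a []//|a []//]|/not_andP[/contrapT|/contrapT]]; [left|right].
Qed.
Lemma Dfn_imp P Q : Dfn P -> Dfn Q -> Dfn (fun v => P v -> Q v).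
Proof.
move=> p /Dfn_not q; apply: (Dfn_iff (Dfn_not (Dfn_and p q))) => v _.
by split=> [a [] /a//|h Pv]; apply: contrapT => nQ; apply: h.
Qed.
Lemma Dfn_equiv P Q : Dfn P -> Dfn Q -> Dfn (fun v => P v <-> Q v).
Proof. by move=> p q; apply: Dfn_and; apply: Dfn_imp. Qed.
Lemma Dfn_all (B : (nat -> V) -> V -> Prop) : Dfn (fun v => B (fun n => v n.+1) (v 0)) ->
  Dfn (fun v => forall x, H x -> B v x).
Proof.
move=> [p Mp h]; exists (DAll p) => // v Hv /=.
have E x : H x -> B v x <-> deval H (scons x v) p by move=> Hx; apply: (h (scons x v)) => -[].
by split=> b x Hx; apply/E => //; apply: b.
Qed.
Lemma Dfn_ex (B : (nat -> V) -> V -> Prop) : Dfn (fun v => B (fun n => v n.+1) (v 0)) ->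
  Dfn (fun v => exists2 x, H x & B v x).
Proof.
move=> /Dfn_not /(@Dfn_all (fun v x => ~ B v x)) /Dfn_not /Dfn_iff; apply => v _.
by split=> [[x Hx b] /(_ x Hx)//|h]; apply: contrapT => n; apply: h => x Hx b; apply: n; exists x.
Qed.
(** Transitivity of [H] makes bounded quantifiers over the universe and over [H] agree, so bounded
    notions need no relativization. *)
Lemma Dfn_ball t (B : (nat -> V) -> V -> Prop) : trm t ->
  Dfn (fun v => B (fun n => v n.+1) (v 0)) -> Dfn (fun v => forall x, x ∈ t v -> B v x).
Proof.
move=> tt b; have c := Dfn_imp (Dfn_mem (trm_var 0) (trm_shift tt)) b.
apply: (Dfn_iff (@Dfn_all (fun v x => x ∈ t v -> B v x) c)) => v Hv.
by split=> h x; [move=> _; apply: h|move=> xt; apply: h => //; apply: HT xt; apply: trmH].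
Qed.
Lemma Dfn_bex t (B : (nat -> V) -> V -> Prop) : trm t ->
  Dfn (fun v => B (fun n => v n.+1) (v 0)) -> Dfn (fun v => exists2 x, x ∈ t v & B v x).
Proof.
move=> tt b; have c := Dfn_and (Dfn_mem (trm_var 0) (trm_shift tt)) b.
apply: (Dfn_iff (@Dfn_ex (fun v x => x ∈ t v /\ B v x) c)) => v Hv.
split=> [[x xt Bx]|[x _ []]]; last by exists x.
by exists x => //; apply: HT xt; apply: trmH.
Qed.
Lemma Dfn_or3 P Q R : Dfn P -> Dfn Q -> Dfn R -> Dfn (fun v => [\/ P v, Q v | R v]).
Proof.
move=> p q r; apply: (Dfn_iff (Dfn_or p (Dfn_or q r))) => v _.
by split=> [[]h|[h|[h|h]]]; [left|right; left|right; right|apply: Or31|apply: Or32|apply: Or33].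
Qed.
Lemma Dfn_and3 P Q R : Dfn P -> Dfn Q -> Dfn R -> Dfn (fun v => [/\ P v, Q v & R v]).
Proof.
move=> p q r; apply: (Dfn_iff (Dfn_and p (Dfn_and q r))) => v _.
by split=> [[]|[? []]].
Qed.
Lemma Dfn_and4 P Q R S : Dfn P -> Dfn Q -> Dfn R -> Dfn S ->
  Dfn (fun v => [/\ P v, Q v, R v & S v]).
Proof.
move=> p q r s; apply: (Dfn_iff (Dfn_and p (Dfn_and3 q r s))) => v _.
by split=> [[]|[? []]].
Qed.

Lemma tarski_vaught (P : V -> Prop) : Dfn (fun v => P (v 0)) ->
  (exists2 x, H x & P x) -> exists2 x, M x & P x.
Proof.
move=> [p Mp h] [x Hx Px]; have [[m0 Mm0] _ _] := MH.
have E y : H y -> P y <-> deval H (scons y (fun=> m0)) p.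
  by move=> Hy; apply: (h (scons y (fun=> m0))) => -[|i] //=; apply: MsubH.
have : deval H (fun=> m0) (DNot (DAll (DNot p))) by move=> /(_ x Hx); apply; apply/E.
move=> /(@deval_elem (DNot (DAll (DNot p))) _ Mp)/= => h1.
have {h1} := h1 (fun _ => Mm0) => h1.
apply: contrapT => n; apply: h1 => y My dy; apply: n; exists y => //.
apply/E; first exact: MsubH.
by apply/deval_elem => // -[].
Qed.

Lemma M_uniq (P : V -> Prop) x : Dfn (fun v => P (v 0)) -> H x -> P x ->
  (forall y, H y -> P y -> y = x) -> M x.
Proof.
move=> dP Hx Px u; have [|y My Py] := tarski_vaught dP; first by exists x.
by rewrite -(u y) //; apply: MsubH.
Qed.

End Definability.

Ltac dfn_trm := cbv beta; lazymatch goal with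
  | |- trm _ (fun v => ?s v) => assumption
  | |- trm _ (fun v => v _) => exact: trm_var
  | |- trm _ (fun v => ?s (fun n => v n.+1)) =>
      refine (@trm_shift _ _ s _); dfn_trm
  | |- trm _ (fun v => ?s (fun n => v n.+2)) =>
      refine (@trm_shift _ _ (fun v => s (fun n => v n.+1)) _); dfn_trm
  | |- trm _ (fun v => ?s (fun n => v n.+3)) =>
      refine (@trm_shift _ _ (fun v => s (fun n => v n.+2)) _); dfn_trm
  | |- trm _ (fun v => ?s (fun n => v n.+4)) =>
      refine (@trm_shift _ _ (fun v => s (fun n => v n.+3)) _); dfn_trm
  | |- trm _ _ => by [assumption | apply: trm_cst]
  end.

Ltac dfn_concept := fail.
Ltac dfn := cbv beta; lazymatch goal with
  | |- Dfn _ _ (fun v => _ ∈ _) => apply: Dfn_mem; dfn_trm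
  | |- Dfn _ _ (fun v => _ = _) => apply: Dfn_eq; dfn_trm
  | |- Dfn _ _ (fun v => ~ _) => apply: Dfn_not; dfn
  | |- Dfn _ _ (fun v => _ /\ _) => apply: Dfn_and; dfn
  | |- Dfn _ _ (fun v => _ \/ _) => apply: Dfn_or; dfn
  | |- Dfn _ _ (fun v => _ <-> _) => apply: Dfn_equiv; dfn
  | |- Dfn _ _ (fun v => [/\ _, _ & _]) => apply: Dfn_and3; dfn
  | |- Dfn _ _ (fun v => [/\ _, _, _ & _]) => apply: Dfn_and4; dfn
  | |- Dfn _ _ (fun v => [\/ _, _ | _]) => apply: Dfn_or3; dfn
  | |- Dfn ?H _ (fun v => exists2 x, ?H x & @?B v x) => apply: (@Dfn_ex _ _ _ B); dfn
  | |- Dfn _ _ (fun v => exists2 x, x ∈ @?t v & @?B v x) =>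
      apply: (@Dfn_bex _ _ _ ltac:(eassumption) ltac:(eassumption) t B); [dfn_trm | dfn]
  | |- Dfn ?H _ (fun v => forall x, ?H x -> @?B v x) => apply: (@Dfn_all _ _ _ B); dfn
  | |- Dfn _ _ (fun v => forall x, x ∈ @?t v -> @?B v x) =>
      apply: (@Dfn_ball _ _ _ ltac:(eassumption) ltac:(eassumption) t B); [dfn_trm | dfn]
  | |- Dfn _ _ (fun v => forall x : carrier _, _) => first [dfn_concept | idtac]
  | |- Dfn _ _ (fun v => _ -> _) => apply: Dfn_imp; dfn
  | _ => first [dfn_concept | idtac] end.

(** * Formulas for the notions evaluated inside [M] *)

Section Concepts.
Variable V : zfc_universe.
Variables (H M : set V).
Hypothesis HT : forall x y, H y -> x ∈ y -> H x.
Hypothesis MH : elementary M H.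
Implicit Types s t u : (nat -> V) -> V.

Lemma Dfn_sub s t : trm M s -> trm M t -> Dfn H M (fun v => ext (s v) `<=` ext (t v)).
Proof.
move=> ts tt; have d : Dfn H M (fun v => forall x, x ∈ s v -> x ∈ t v) by dfn.
exact: (Dfn_iff d).
Qed.
Lemma Dfn_le_ord s t : trm M s -> trm M t -> Dfn H M (fun v => le_ord (s v) (t v)).
Proof. by move=> ts tt; rewrite /le_ord; dfn. Qed.

Lemma Dfn_ordinal s : trm M s -> Dfn H M (fun v => is_ordinal (s v)).
Proof.
move=> ts.
have d : Dfn H M (fun v => (forall y, y ∈ s v -> forall z, z ∈ y -> z ∈ s v) /\
   (forall y, y ∈ s v -> forall z, z ∈ s v -> [\/ y ∈ z, y = z | z ∈ y])) by dfn.
by apply: (Dfn_iff d) => v _; split=> -[a b]; split=> // y; [move=> ys z zs|move=> z ys zs]; apply: b.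
Qed.

Lemma Dfn_lim s : trm M s -> Dfn H M (fun v => limit_ordinal (s v)).
Proof.
move=> ts; have d1 := Dfn_ordinal ts.
have d : Dfn H M (fun v => [/\ is_ordinal (s v), exists2 x, x ∈ s v & x = x &
    forall y, y ∈ s v -> exists2 z, z ∈ s v & y ∈ z]) by apply: Dfn_and3 => //; dfn.
by apply: (Dfn_iff d) => v _; split=> -[a [x b] c]; split=> //; exists x.
Qed.

Lemma Dfn_unb s t : trm M s -> trm M t -> Dfn H M (fun v => unb (s v) (t v)).
Proof. by move=> ts tt; rewrite /unb; dfn. Qed.

Lemma Dfn_limit_point s t : trm M s -> trm M t -> Dfn H M (fun v => limit_point (s v) (t v)).
Proof. by move=> ts tt; apply: Dfn_and; [apply: Dfn_lim|apply: Dfn_unb]. Qed.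

Lemma Dfn_club s t : trm M s -> trm M t -> Dfn H M (fun v => club (s v) (t v)).
Proof.
move=> ts tt; apply: Dfn_and3; first exact: Dfn_sub; first by dfn.
dfn; apply: Dfn_limit_point; dfn_trm.
Qed.

Definition inF (F a b : V) := opair a b ∈ F.
Lemma Dfn_inF s t u : trm M s -> trm M t -> trm M u ->
  Dfn H M (fun v => inF (s v) (t v) (u v)).
Proof.
move=> ts tt tu.
have d : Dfn H M (fun v => exists2 p, p ∈ s v & exists2 x, x ∈ p & exists2 y, y ∈ p &
    (forall z, z ∈ p -> z = x \/ z = y) /\
    [/\ t v ∈ x, forall z, z ∈ x -> z = t v, t v ∈ y & u v ∈ y /\ forall z, z ∈ y -> z = t v \/ z = u v]).
  by dfn.
apply: (Dfn_iff d) => v _; split=> [h|[p ps [x xp [y yp [pE [tx xE ty [uy yE]]]]]]].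
  exists (opair (t v) (u v)) => //.
  exists (upair (t v) (t v)); first by apply/upairE; left.
  exists (upair (t v) (u v)); first by apply/upairE; right.
  split; first by move=> z /upairE.
  split=> [|z /upairE[]//||]; try by apply/upairE; left.
  by split=> [|z /upairE//]; apply/upairE; right.
rewrite /inF; suff <- : p = opair (t v) (u v) by []; rewrite /opair.
have {xE}<- : x = upair (t v) (t v).
  by apply: set_eq => z; split=> [/xE->|/upairE[]->//]; apply/upairE; left.
have {yE}<- : y = upair (t v) (u v).
  by apply: set_eq => z; split=> [/yE/upairE|/upairE[]->].
by have <- : p = upair x y by apply: set_eq => z; split=> [/pE/upairE|/upairE[]->].
Qed.

(** A partial surjection of [mu] onto [x], single-valued only within [x]: the same [F] then serves
    every subset of [x], and an index determines its value. *)
Definition enumerates F mu x : Prop := (forall z, z ∈ x -> exists2 i, i ∈ mu & inF F i z) /\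
  (forall i, i ∈ mu -> forall z, z ∈ x -> forall z', z' ∈ x -> inF F i z -> inF F i z' -> z = z').

Lemma Dfn_enumerates s t u : trm M s -> trm M t -> trm M u ->
  Dfn H M (fun v => enumerates (s v) (t v) (u v)).
Proof. by move=> ts tt tu; rewrite /enumerates; dfn; apply: Dfn_inF; dfn_trm. Qed.

(** For sets of members of [H], this is size less than [kap] in first-order form; [ksmall_card] and
    [card_ksmall] translate. *)
Definition ksmall kap x := exists2 mu, mu ∈ kap & exists2 F, H F & enumerates F mu x.
Lemma Dfn_ksmall s t : trm M s -> trm M t -> Dfn H M (fun v => ksmall (s v) (t v)).
Proof. by move=> ts tt; rewrite /ksmall; dfn; apply: Dfn_enumerates; dfn_trm. Qed.

(* On limit ordinals this is cofinality below [kap]; it fails at successors. *)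
Definition cofk kap beta := exists2 a, H a & [/\ ext a `<=` ext beta, unb a beta & ksmall kap a].
Lemma Dfn_cofk s t : trm M s -> trm M t -> Dfn H M (fun v => cofk (s v) (t v)).
Proof.
move=> ts tt; rewrite /cofk; dfn.
- by apply: Dfn_sub; dfn_trm.
- by apply: Dfn_unb; dfn_trm.
- by apply: Dfn_ksmall; dfn_trm.
Qed.

(* Cofinality [omega], expressed without functions. *)
Definition cofw beta := exists2 a, H a &
  [/\ ext a `<=` ext beta, unb a beta & forall z, z ∈ beta -> ~ limit_point a z].
Lemma Dfn_cofw s : trm M s -> Dfn H M (fun v => cofw (s v)).
Proof.
move=> ts; rewrite /cofw; dfn.
- by apply: Dfn_sub; dfn_trm.
- by apply: Dfn_unb; dfn_trm.
- by apply: Dfn_limit_point; dfn_trm.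
Qed.

Definition cap (x y : V) := sep x (ext y).
Lemma capE x y z : z ∈ cap x y <-> z ∈ x /\ z ∈ y.
Proof. exact: sepE. Qed.
Definition cap_in T c b := cap c b ∈ T.
Lemma Dfn_cap_in s t u : trm M s -> trm M t -> trm M u ->
  Dfn H M (fun v => cap_in (s v) (t v) (u v)).
Proof.
move=> ts tt tu; have d : Dfn H M (fun v => exists2 d, d ∈ s v &
  (forall z, z ∈ d -> z ∈ t v /\ z ∈ u v) /\ (forall z, z ∈ t v -> z ∈ u v -> z ∈ d)) by dfn.
apply: (Dfn_iff d) => v _; split=> [h|[c cs [a b]]].
  by exists (cap (t v) (u v)) => //; split=> [z /capE//|z zt zu]; apply/capE.
rewrite /cap_in; suff -> : cap (t v) (u v) = c by [].
by apply: set_eq => z; split=> [/capE[]|/a/capE//]; apply: b.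
Qed.

(* [T] codes a square-like sequence on [gamma]: a club of [alpha] determines
   [alpha], so the member of index [alpha] is the set of [c ∈ T] club in [alpha]. *)
Definition presq kap T gamma := forall alpha, alpha ∈ gamma ->
  limit_ordinal alpha -> cofk kap alpha ->
  [/\ exists2 c, c ∈ T & club c alpha,
     exists2 s, H s & (forall c, c ∈ T -> club c alpha -> c ∈ s) /\ ksmall kap s &
     forall c, c ∈ T -> club c alpha -> forall beta, H beta -> limit_point c beta ->
       cofk kap beta -> cap_in T c beta].
Definition thread kap T gamma D := club D gamma /\
  forall beta, beta ∈ gamma -> limit_point D beta -> cofk kap beta -> cap_in T D beta.
(** Bounding [T] and [D] by [H] makes this a formula over [H]. For [gamma] in [H_theta] no thread is
    lost, as threads are subsets of [gamma]. *)
Definition bad kap gamma := [/\ limit_ordinal gamma, ~ cofk kap gamma &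
  exists2 T, H T & presq kap T gamma /\ ~ exists2 D, H D & thread kap T gamma D].

End Concepts.

Ltac dfn_concept ::= lazymatch goal with
  | |- Dfn _ _ (fun v => ext _ `<=` ext _) =>
      apply: (@Dfn_sub _ _ _ ltac:(eassumption) ltac:(eassumption)); dfn_trm
  | |- Dfn _ _ (fun v => le_ord _ _) => apply: Dfn_le_ord; dfn_trm
  | |- Dfn _ _ (fun v => is_ordinal _) =>
      apply: (@Dfn_ordinal _ _ _ ltac:(eassumption) ltac:(eassumption)); dfn_trm
  | |- Dfn _ _ (fun v => limit_ordinal _) =>
      apply: (@Dfn_lim _ _ _ ltac:(eassumption) ltac:(eassumption)); dfn_trm
  | |- Dfn _ _ (fun v => unb _ _) =>
      apply: (@Dfn_unb _ _ _ ltac:(eassumption) ltac:(eassumption)); dfn_trm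
  | |- Dfn _ _ (fun v => limit_point _ _) =>
      apply: (@Dfn_limit_point _ _ _ ltac:(eassumption) ltac:(eassumption)); dfn_trm
  | |- Dfn _ _ (fun v => club _ _) =>
      apply: (@Dfn_club _ _ _ ltac:(eassumption) ltac:(eassumption)); dfn_trm
  | |- Dfn _ _ (fun v => inF _ _ _) =>
      apply: (@Dfn_inF _ _ _ ltac:(eassumption) ltac:(eassumption)); dfn_trm
  | |- Dfn _ _ (fun v => ksmall _ _ _) =>
      apply: (@Dfn_ksmall _ _ _ ltac:(eassumption) ltac:(eassumption)); dfn_trm
  | |- Dfn _ _ (fun v => cofk _ _ _) =>
      apply: (@Dfn_cofk _ _ _ ltac:(eassumption) ltac:(eassumption)); dfn_trm
  | |- Dfn _ _ (fun v => cofw _ _) =>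
      apply: (@Dfn_cofw _ _ _ ltac:(eassumption) ltac:(eassumption)); dfn_trm
  | |- Dfn _ _ (fun v => cap_in _ _ _) =>
      apply: (@Dfn_cap_in _ _ _ ltac:(eassumption) ltac:(eassumption)); dfn_trm
  end.

Lemma Dfn_bad (V : zfc_universe) (H M : set V)
  (HT : forall x y, H y -> x ∈ y -> H x) (MH : elementary M H) s t :
  trm M s -> trm M t -> Dfn H M (fun v => bad H (s v) (t v)).
Proof. by move=> ts tt; rewrite /bad /presq /thread; dfn. Qed.

(** * Guessing models *)

Section Limits.
Variable V : zfc_universe.
Implicit Types x y z a b c beta gamma xi : V.

Lemma unb_unique a x y : is_ordinal x -> is_ordinal y -> unb a x -> unb a y ->
  (forall z, z ∈ a -> z ∈ x) -> (forall z, z ∈ a -> z ∈ y) -> x = y.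
Proof.
move=> ox oy ux uy ax ay; case: (ord_total ox oy) => // h.
  by have [z /ax zx [xz _]] := uy _ h; case: (elem_asym zx xz).
by have [z /ay zy [yz _]] := ux _ h; case: (elem_asym zy yz).
Qed.

Lemma lim_two gamma x y : limit_ordinal gamma -> x ∈ gamma -> y ∈ gamma ->
  exists2 c, c ∈ gamma & x ∈ c /\ y ∈ c.
Proof.
move=> lg xg yg; have og := lim_ord lg.
case: (ord_total (ord_elem og xg) (ord_elem og yg)) => [xy|->|yx].
- exists (adj y y); first exact: lim_succ.
  by split; apply/adjE; [left|right].
- exists (adj y y); first exact: lim_succ.
  by split; apply/adjE; right.
- exists (adj x x); first exact: lim_succ.
  by split; apply/adjE; [right|left].
Qed.

Lemma lim_emp gamma : limit_ordinal gamma -> emp V ∈ gamma.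
Proof.
move=> [og [x xg] _].
have [|z [oz zg zm]] := @ord_least V (fun z => z ∈ gamma).
  by exists x => //; apply: ord_elem xg.
rewrite -(@emp_eq _ z) // => y yz; apply: (zm y yz); exact: ord_trans yz zg.
Qed.

Lemma not_unb_bound gamma a : limit_ordinal gamma -> ~ unb a gamma ->
  exists2 b, b ∈ gamma & forall z, z ∈ a -> z ∈ gamma -> z ∈ b.
Proof.
move=> lg nu; have og := lim_ord lg; apply: contrapT => h; apply: nu => x xg.
apply: contrapT => h'; apply: h; exists (adj x x); first exact: lim_succ.
move=> z za zg; apply/adjE.
have := ord_leP (ord_elem og xg) (ord_elem og zg); apply => xz; apply: h'.
by exists z.
Qed.

Lemma club_cap c gamma xi : is_ordinal gamma -> club c gamma -> xi ∈ gamma ->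
  limit_point c xi -> club (cap c xi) xi.
Proof.
move=> og [cg _ cl] xg [lx ux]; split.
- by move=> z /capE[].
- by move=> b /ux[y yc [byy yx]]; exists y => //; apply/capE.
- move=> b bx lb; apply/capE; split=> //; apply: cl; first exact: ord_trans bx xg.
  by apply: limit_point_mono lb _ => z /capE[].
Qed.

(** Dependent choice, in which each step also leaves a by-product [b n] to be interleaved with the
    points [x n]. *)
Lemma step_sequence (P : V -> Prop) (R : V -> V -> V -> Prop) x0 :
  (forall x, P x -> exists b y, P y /\ R x b y) -> P x0 ->
  exists x b : nat -> V, x 0 = x0 /\ forall n, P (x n) /\ R (x n) (b n) (x n.+1).
Proof.
move=> h Px0.
have h' (x : {x | P x}) : exists p : V * {y | P y}, R (sval x) p.1 (sval p.2).
  by have [b [y [Py r]]] := h _ (svalP x); exists (b, exist _ y Py).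
pose f (u : {x | P x}) := sval (cid (h' u)); pose s := fix s n := if n is n'.+1 then (f (s n')).2 else exist _ x0 Px0.
exists (fun n => sval (s n)), (fun n => (f (s n)).1); split=> // n; split; first exact: svalP.
exact: (svalP (cid (h' (s n)))).
Qed.

(* [K] is cofinal with proper initial segments of size less than the cofinality. *)
Lemma thin_cofinal gamma : limit_ordinal gamma -> exists K, [/\ ext K `<=` ext gamma,
  unb K gamma & forall x (g : V -> V), x ∈ gamma ->
    (forall k, k ∈ K -> k ∈ x -> g k ∈ gamma) ->
    exists2 b, b ∈ gamma & forall k, k ∈ K -> k ∈ x -> g k ∈ b].
Proof.
move=> lg; have og := lim_ord lg.
have [|mu [omu [a ag [ua /card_le_enum[h hE]]] mumin]] := @ord_least V (fun mu =>
    exists2 a, ext a `<=` ext gamma & unb a gamma /\ ext a #<= ext mu).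
  exists gamma => //; exists gamma => //; split; last exact: card_lexx.
  by move=> x xg; exists (adj x x); [|split; first (by apply/adjE; right)]; exact: lim_succ.
have oag z : z ∈ a -> is_ordinal z by move=> /ag; apply: ord_elem.
(* [K] keeps the record values of the enumeration [h]. If [z = h i0] lies above [x], every record
   below [x] must occur at an index before [i0]. *)
pose K := sep a (fun z => exists2 i, i ∈ mu & h i = z /\ forall j, j ∈ i -> h j ∈ a -> h j ∈ z).
exists K; split=> [z /sepE[/ag]//||].
  move=> x xg; have [z za [xz zg]] := ua _ xg; have [i0 i0mu hi0] := hE _ za.
  have [|i [oi [imu [hia xhi]] imin]] := @ord_least V (fun i => i ∈ mu /\ h i ∈ a /\ x ∈ h i).
    by exists i0; [exact: ord_elem i0mu|rewrite hi0].
  exists (h i); last by split=> //; exact: ag.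
  apply/sepE; split=> //; exists i => //; split=> // j ji hja.
  have : ~ x ∈ h j by move=> xj; apply: (imin j ji); split=> //; exact: ord_trans ji imu.
  move=> /(ord_leP (ord_elem og xg) (oag _ hja)) jx.
  by apply: ord_le_lt jx xhi; exact: oag.
move=> x g xg gK; have [z za [xz zg]] := ua _ xg; have [i0 i0mu hi0] := hE _ za.
(* An unbounded image of [K ∩ x] would be enumerated by [i0], against the minimality of [mu]. *)
have [|b bg bP] := @not_unb_bound gamma (repl g (cap K x)) lg.
  move=> ur; apply: (mumin i0 i0mu); exists (repl g (cap K x)).
    by move=> _ /replE[k /capE[kK kx] ->]; apply: gK.
  split=> //; apply: (enum_card_le (g := g \o h)) => _ /replE[k /capE[kK kx] ->].
  have /sepE[ka [i imu [hik imin]]] := kK; exists i; last by rewrite /= hik.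
  have ox := ord_elem og xg.
  case: (ord_total (ord_elem omu imu) (ord_elem omu i0mu)) => // [e|ii0].
    by case: (@elem_asym _ x z) => //; rewrite -hi0 -e hik.
  have /imin : i0 ∈ i by []. rewrite hi0 => /(_ za) zk.
  case: (@elem_asym _ x z) => //; exact: ord_trans zk kx.
by exists b => // k kK kx; apply: bP; [apply: mem_repl; apply/capE|exact: gK].
Qed.

(** * Suprema of interleaved omega-sequences *)

Section Sequence.
Variables (x b : nat -> V).
Hypothesis ox : forall n, is_ordinal (x n).
Hypothesis xb : forall n, x n ∈ b n.
Hypothesis bx : forall n, b n ∈ x n.+1.

Definition seqsup := union (nrange x).

Lemma seqsupE y : y ∈ seqsup <-> exists n, y ∈ x n.
Proof.
split=> [/unionE[_ /nrangeE[n ->] yx]|[n yx]]; first by exists n.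
by apply/unionE; exists (x n) => //; apply/nrangeE; exists n.
Qed.

Lemma seq_lt n : x n ∈ x n.+1.
Proof. exact: ord_trans (xb n) (bx n). Qed.

Lemma seq_le m n : m <= n -> le_ord (x m) (x n).
Proof.
elim: n => [|n IH]; first by rewrite leqn0 => /eqP->; right.
rewrite leq_eqVlt ltnS => /predU1P[->|/IH h]; first by right.
by left; apply: ord_le_lt (seq_lt n).
Qed.

Lemma seq_sup n : x n ∈ seqsup.
Proof. by apply/seqsupE; exists n.+1; exact: seq_lt. Qed.

Lemma seqb_sup n : b n ∈ seqsup.
Proof. by apply/seqsupE; exists n.+1. Qed.

Lemma seqsup_lim : limit_ordinal seqsup.
Proof.
split; first by apply: ord_union => a /nrangeE[n ->].
  by exists (x 0); exact: seq_sup.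
by move=> y /seqsupE[n yx]; exists (x n) => //; exact: seq_sup.
Qed.

Lemma seq_unb : unb (nrange b) seqsup.
Proof.
move=> y /seqsupE[n yx]; exists (b n); first by apply/nrangeE; exists n.
split; last exact: seqb_sup.
by apply: ord_trans yx (xb n); apply: ord_elem (bx n).
Qed.

(** If [k] is least with [x k] not below [z], only the finitely many [b j] with [j < k] lie below
    [z], and they have a last element. *)
Lemma seq_nolim z : z ∈ seqsup -> ~ limit_point (nrange b) z.
Proof.
move=> /seqsupE[n zn] [lz uz]; have oz := lim_ord lz.
pose p n := `[< ~ x n ∈ z >].
have ep : exists n, p n by exists n; apply/asboolP; exact: elem_asym.
case: (ex_minnP ep) => k /asboolP nk kmin.
have zk : le_ord z (x k) by apply: ord_leP.
have jlt j : b j ∈ z -> j < k.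
  move=> bz; rewrite ltnNge; apply/negP => /seq_le kj.
  have zj : le_ord z (x j).
    case: zk => [zk|->] //; left; case: kj => [kj|<-] //; exact: ord_trans zk kj.
  have bj := ord_lt_le (ox j) bz zj.
  exact: elem_asym (xb j) bj.
case: k {nk zk} kmin jlt => [|k] kmin jlt.
  have [_ [y yz] _] := lz; have [_ /nrangeE[j ->] [_ /jlt]] := uz _ yz.
  by rewrite ltn0.
have xk : x k ∈ z.
  apply: contrapT => h; have : k < k by apply: kmin; apply/asboolP.
  by rewrite ltnn.
have bk y : y ∈ z -> le_ord (x k) y -> y ∈ b k /\ b k ∈ z.
  move=> yz ky; have [_ /nrangeE[j ->] [yj bz]] := uz _ yz.
  have := jlt _ bz; rewrite ltnS leq_eqVlt => /predU1P[e|jk]; first by rewrite -e.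
  have obj := ord_elem oz bz.
  have : b j ∈ x k by apply: ord_lt_le (bx j) (seq_le jk).
  by move=> /(elem_asym (ord_le_lt obj ky yj)).
have [kb bz] := bk _ xk (or_intror erefl).
by have [/elem_irr] := bk _ bz (or_introl kb).
Qed.
End Sequence.

End Limits.

(** * Closure of [M], small sets, and the first use of guessing *)

Section Guessing.
Variables (V : zfc_universe) (theta delta kappa M : V).
Hypothesis theta_regular : regular_cardinal theta.
Hypothesis M_elementary : elementary (ext M) (Hset theta).
Hypothesis kappa_M : is_kappa M kappa.
Hypothesis delta_kappa : delta ∈ kappa.
Hypothesis M_guessing : guessing theta delta M.
Local Notation H := (Hset theta).
Implicit Types x y z a b c e beta gamma eta : V.

Let HT : forall x y, H y -> x ∈ y -> H x := H_trans theta_regular.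
Let Hsub : forall x y, H y -> ext x `<=` ext y -> H x := H_sub theta_regular.

Lemma M_H x : x ∈ M -> H x.
Proof. exact: (MsubH M_elementary). Qed.

Let kM : kappa ∈ M. Proof. by case: kappa_M. Qed.
Let ok : is_ordinal kappa. Proof. by case: kappa_M. Qed.

Lemma gap : exists2 x, x ∈ kappa & ~ x ∈ M.
Proof.
apply: contrapT => h; case: kappa_M => _ _ + _; apply.
rewrite eqEsubset; split=> [x []//|x xk]; split=> //.
by apply: contrapT => nx; apply: h; exists x.
Qed.

Lemma kappa_init b x : b ∈ kappa -> b ∈ M -> x ∈ b -> x ∈ M.
Proof.
move=> bk bM xb; apply: contrapT => nx; case: kappa_M => _ _ _ h.
have /h : is_ordinal b by apply: ord_elem bk.
case=> // [e|kb|e]; last by subst b; exact: (elem_irr bk).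
  have : ext b x by [].
  by rewrite -e => -[].
exact: (elem_asym bk kb).
Qed.

Lemma TV (P : V -> Prop) : Dfn H (ext M) (fun v => P (v 0)) ->
  (exists2 x, H x & P x) -> exists2 x, x ∈ M & P x.
Proof. exact: (tarski_vaught M_elementary). Qed.

Lemma MU (P : V -> Prop) x : Dfn H (ext M) (fun v => P (v 0)) -> H x -> P x ->
  (forall y, H y -> P y -> y = x) -> x ∈ M.
Proof. exact: (M_uniq M_elementary). Qed.

Lemma M_ext x y : x ∈ M -> y ∈ M -> (forall z, z ∈ M -> z ∈ x <-> z ∈ y) -> x = y.
Proof.
move=> xM yM xy; apply: set_eq => z; apply: contrapT => h.
have [w wM hw] : exists2 w, w ∈ M & ((w ∈ x /\ ~ w ∈ y) \/ (w ∈ y /\ ~ w ∈ x)).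
  apply: TV; first by dfn.
  have {}h : (z ∈ x /\ ~ z ∈ y) \/ (z ∈ y /\ ~ z ∈ x).
    apply: contrapT => n; apply: h; split=> k; apply: contrapT => l; apply: n; by [left|right].
  by exists z => //; case: h => -[k _]; apply: HT k; apply: M_H.
by have := xy w wM; case: hw => -[a b] [c d]; [apply: b; apply: c|apply: b; apply: d].
Qed.

Lemma M_sep (Q : V -> Prop) x : Dfn H (ext M) (fun v => Q (v 0)) -> x ∈ M -> sep x Q ∈ M.
Proof.
move=> dQ xM.
apply: (@MU (fun y => (forall z, z ∈ y -> z ∈ x /\ Q z) /\ (forall z, z ∈ x -> Q z -> z ∈ y))).
- by dfn.
- by apply: (H_sep theta_regular); apply: M_H.
- by split=> [z /sepE//|z zx Qz]; apply/sepE.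
- move=> y _ [h1 h2]; apply: set_eq => z; split=> [/h1[zx Qz]|/sepE[]]; last exact: h2.
  by apply/sepE.
Qed.

Lemma M_cap x y : x ∈ M -> y ∈ M -> cap x y ∈ M.
Proof.
move=> xM yM; have d : Dfn H (ext M) (fun v => v 0 ∈ y) by dfn.
exact: (M_sep d xM).
Qed.

Lemma M_adj x y : x ∈ M -> y ∈ M -> adj x y ∈ M.
Proof.
move=> xM yM.
apply: (@MU (fun w => (forall z, z ∈ w -> z ∈ x \/ z = y) /\ (forall z, z ∈ x -> z ∈ w) /\ y ∈ w)).
- by dfn.
- by apply: (H_adj theta_regular); apply: M_H.
- split=> [z /adjE//|]; split=> [z zx|]; apply/adjE; by [left|right].
- move=> w _ [h1 [h2 h3]]; apply: set_eq => z; split=> [/h1/adjE//|/adjE[/h2//|->//]].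
Qed.

Lemma M_emp : emp V ∈ M.
Proof.
apply: (@MU (fun w => forall z, z ∈ w -> ~ z = z)); first by dfn.
- exact: H_emp.
- by move=> z /empE.
- by move=> y _ h; apply: emp_eq => z /h.
Qed.

Lemma ksmall_card x : ksmall H kappa x -> exists2 mu, mu ∈ kappa & ext x #<= ext mu.
Proof.
move=> [mu muk [F HF [F1 F2]]]; exists mu => //.
pose g i := if pselect (exists2 z, z ∈ x & inF F i z) is left h then sval (cid2 h) else i.
apply: (enum_card_le (g := g)) => z zx; have [i imu iz] := F1 z zx; exists i => //.
rewrite /g; case: pselect => [h|[]]; last by exists z.
by case: cid2 => z' /= z'x iz'; apply: (F2 i).
Qed.

Lemma card_ksmall x mu : (forall z, z ∈ x -> H z) -> mu ∈ kappa -> ext x #<= ext mu ->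
  ksmall H kappa x.
Proof.
move=> Hx muk /card_le_enum[g gE]; exists mu => //.
have Hmu : H mu by apply: HT muk; apply: M_H.
pose g' i := if pselect (g i ∈ x) is left _ then g i else i.
have g'E i : g i ∈ x -> g' i = g i by rewrite /g'; case: pselect.
exists (repl (fun i => opair i (g' i)) mu).
  apply: (H_repl theta_regular) => // i imu; apply: (H_opair theta_regular); first exact: HT imu.
  by rewrite /g'; case: pselect => [/Hx//|_]; exact: HT imu.
split=> [z zx|i imu z zx z' z'x /replE[j _ /opair_inj[-> ->]] /replE[k _ /opair_inj[-> ->]]//].
have [i imu gi] := gE z zx; exists i => //; apply/replE; exists i => //.
by rewrite g'E gi.
Qed.

Lemma ksmall_sub x y : ksmall H kappa x -> ext y `<=` ext x -> ksmall H kappa y.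
Proof.
move=> [mu muk [F HF [F1 F2]]] yx; exists mu => //; exists F => //.
split=> [z /yx/F1//|i imu z /yx zx z' /yx z'x]; exact: F2.
Qed.

Lemma ksmall_image (f : V -> V) x : ksmall H kappa x -> (forall z, z ∈ x -> H (f z)) ->
  ksmall H kappa (repl f x).
Proof.
move=> /ksmall_card[mu muk xmu] Hf; apply: (card_ksmall _ muk).
  by move=> z /replE[i ix ->]; apply: Hf.
apply: card_le_trans xmu; apply: (enum_card_le (g := f)) => z /replE[i ix ->].
by exists i.
Qed.

(** The index ordinal and the enumeration can be taken in [M]. By leastness of [kappa] all indices
    are in [M], so every value is definable from parameters in [M]. *)
Lemma ksmall_subM x : x ∈ M -> ksmall H kappa x -> ext x `<=` ext M.
Proof.
move=> xM [mu0 mu0k hF0].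
have [mu muM [muk hF]] : exists2 mu, mu ∈ M & mu ∈ kappa /\ exists2 F, H F & enumerates F mu x.
  apply: TV; first by rewrite /enumerates; dfn.
  by exists mu0 => //; apply: HT mu0k; apply: M_H.
have [F FM [F1 F2]] : exists2 F, F ∈ M & enumerates F mu x by apply: TV => //; rewrite /enumerates; dfn.
move=> z zx; have [i imu iz] := F1 z zx; have iM := kappa_init muk muM imu.
apply: (@MU (fun z => z ∈ x /\ inF F i z)) => //; first by dfn.
  by apply: HT zx; apply: M_H.
by move=> y _ [yx iy]; apply: (F2 i).
Qed.

(* If [x] were not small, some injection [kappa -> x] in [M] would pull the
   missing ordinal back into [M]. *)
Lemma subM_ksmall x : x ∈ M -> ext x `<=` ext M -> ksmall H kappa x.
Proof.
move=> xM xsub; have [nu xnu] := is_card_ex x.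
have [[onu _] /card_eqPle[xlenu nulex]] := xnu.
case: (pselect (nu ∈ kappa)) => nuk.
  by apply: (card_ksmall _ nuk) => // z zx; apply: HT zx; apply: M_H.
have kx : ext kappa #<= ext x.
  apply: card_le_trans nulex; apply: subset_card_le; apply: ord_le_sub => //.
  exact: ord_leP.
have [f [fx fI]] := card_le_inj kx.
have Hk := M_H kM.
have [F FM [F1 F2]] : exists2 F, F ∈ M & (forall i, i ∈ kappa -> exists2 z, z ∈ x & inF F i z) /\
    (forall i, i ∈ kappa -> forall j, j ∈ kappa -> forall z, z ∈ x -> inF F i z -> inF F j z -> i = j).
  apply: TV; first by dfn.
  exists (repl (fun i => opair i (f i)) kappa).
    apply: (H_repl theta_regular) => // i ik; apply: (H_opair theta_regular).
      exact: HT ik.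
    by apply: HT (fx _ ik); apply: M_H.
  split=> [i ik|i ik j jk z zx].
    by exists (f i); [exact: fx|apply/replE; exists i].
  move=> /replE[i' _ /opair_inj[<- zi]] /replE[j' _ /opair_inj[<- zj]].
  by apply: fI => //; rewrite -zi.
have [i ik niM] := gap; case: niM; have [z zx iz] := F1 _ ik; have zM := xsub _ zx.
apply: (@MU (fun i => i ∈ kappa /\ inF F i z)) => //; first by dfn.
  exact: HT ik.
by move=> j _ [jk jz]; apply: (F2 j jk i ik z).
Qed.


(** Each member of [a] is the first one or the next after another, since there are no limits; so it
    is definable from [a] and its predecessor. *)
Lemma M_ladder a beta : a ∈ M -> is_ordinal beta -> ext a `<=` ext beta ->
  (forall z, z ∈ beta -> ~ limit_point a z) -> ext a `<=` ext M.
Proof.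
move=> aM ob ab nl; elim/elem_ind => x IH /= xa.
have Hx : H x by apply: HT xa; apply: M_H.
have oa z : z ∈ a -> is_ordinal z by move=> /ab; apply: ord_elem.
case: (@sup_cases _ (cap a x)) => [z /capE[/oa//]|e|[m /capE[ma mx] mmax]|[lu [uu _]]].
- apply: (@MU (fun w => w ∈ a /\ forall y, y ∈ a -> ~ y ∈ w)) => //; first by dfn.
    split=> // y ya yx; apply: (@empE V y); rewrite -e; exact/capE.
  move=> y _ [ya yl]; case: (ord_total (oa _ ya) (oa _ xa)) => // h; last by case: (yl x xa).
  by case: (@empE V y); rewrite -e; apply/capE.
- have mM := IH _ mx ma.
  apply: (@MU (fun w => [/\ w ∈ a, m ∈ w & forall y, y ∈ a -> m ∈ y -> ~ y ∈ w])) => //.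
  + by dfn.
  + split=> // y ya my yx; have /mmax ym : y ∈ cap a x by apply/capE.
    by apply: (@elem_irr _ m); apply: ord_lt_le my ym; exact: oa.
  + move=> y _ [ya my yl]; case: (ord_total (oa _ ya) (oa _ xa)) => // h; last by case: (yl x xa).
    have /mmax ym : y ∈ cap a x by apply/capE.
    by case: (@elem_irr _ m); apply: ord_lt_le my ym; exact: oa.
- case: (@nl (union (cap a x))).
    apply: ord_le_lt (ab _ xa) => //; apply: ord_sub_le => //; [exact: lim_ord|exact: oa|].
    by move=> z /unionE[y /capE[ya yx] zy]; apply: ord_trans zy yx; apply: oa.
  split=> // z /uu[y /capE[ya yx] [zy yu]]; by exists y.
Qed.

(** This stands in for omega being below [kappa]: a ladder in [M] is included in [M], hence
    small. *)
Lemma cofw_cofk beta : beta ∈ M -> is_ordinal beta -> cofw H beta -> cofk H kappa beta.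
Proof.
move=> bM ob hw; have [a aM [ab ub nl]] : exists2 a, a ∈ M &
    [/\ ext a `<=` ext beta, unb a beta & forall z, z ∈ beta -> ~ limit_point a z].
  by apply: TV => //; dfn.
exists a; first exact: M_H.
by split=> //; apply: subM_ksmall => //; exact: M_ladder ob ab nl.
Qed.

Lemma M_bound beta Z : beta ∈ M -> limit_ordinal beta -> ~ cofk H kappa beta ->
  Z ∈ M -> ksmall H kappa Z ->
  exists2 b, b ∈ M & b ∈ beta /\ forall z, z ∈ Z -> z ∈ beta -> z ∈ b.
Proof.
move=> bM lb nc ZM kZ; apply: TV; first by dfn.
have [b bb h] : exists2 b, b ∈ beta & forall z, z ∈ cap Z beta -> z ∈ beta -> z ∈ b.
  apply: not_unb_bound => // u; apply: nc; exists (cap Z beta); first by apply/M_H/M_cap.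
  by split=> // [z /capE[]//|]; apply: ksmall_sub kZ _ => z /capE[].
exists b; first by apply: HT bb; exact: M_H.
by split=> // z zZ zb; apply: h => //; apply/capE.
Qed.

(** Without limit points below [eta], proper initial segments of [d] are finite subsets of [M]; the
    induction adds one point at a time. *)
Lemma M_initial d eta x : ext d `<=` ext M -> ext d `<=` ext eta -> is_ordinal eta ->
  (forall z, z ∈ eta -> ~ limit_point d z) -> x ∈ eta -> cap d x ∈ M.
Proof.
move=> dM de oe nl; elim/elem_ind: x => x IH xe.
have od z : z ∈ d -> is_ordinal z by move=> /de; apply: ord_elem.
case: (@sup_cases _ (cap d x)) => [z /capE[/od//]|->|[m /capE[md mx] mmax]|[lu [uu _]]].
- exact: M_emp.
- have -> : cap d x = adj (cap d m) m; last by apply: M_adj; [apply: IH => //; exact: de|exact: dM].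
  apply: set_eq => z; split=> [h|/adjE[/capE[zd zm]|->]].
  + apply/adjE; case: (mmax _ h) => [zm|->]; last by right.
    by left; apply/capE; split=> //; case/capE: h.
  + by apply/capE; split=> //; apply: ord_trans zm mx; apply: ord_elem xe.
  + exact/capE.
- case: (nl (union (cap d x))).
    have ox := ord_elem oe xe.
    apply: ord_le_lt xe => //; apply: ord_sub_le => //; first exact: lim_ord.
    by move=> z /unionE[y /capE[yd yx] zy]; apply: ord_trans zy yx.
  by split=> // z /uu[y /capE[yd yx] [zy yu]]; exists y.
Qed.

(** Approximation at all sets smaller than [kappa] covers those smaller than [delta], as
    [delta ∈ kappa]; and [d] is in [H_theta] as a subset of [X]. *)
Lemma guess X d : X ∈ M -> ext d `<=` ext X ->
  (forall Z, Z ∈ M -> ksmall H kappa Z -> set_in (ext d `&` ext Z) M) ->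
  exists2 e, e ∈ M & ext e `<=` ext X /\ forall z, z ∈ M -> z ∈ d <-> z ∈ e.
Proof.
move=> XM dX ap; have Hd : H d by apply: Hsub dX; exact: M_H.
have [|e [eM eX de]] := M_guessing XM dX Hd.
  move=> Z ZM [mu [_ /card_eqPle[Zmu _]] mud]; apply: ap => //.
  apply: (card_ksmall (mu := mu)) => // [z zZ|]; first by apply: HT zZ; exact: M_H.
  exact: ord_trans mud delta_kappa.
exists e => //; split=> // z zM.
have E : (ext d `&` ext M) z <-> (ext e `&` ext M) z by rewrite de.
by split=> h; [case: (proj1 E (conj h zM))|case: (proj2 E (conj h zM))].
Qed.

(* A cofinal [omega]-sequence of [M]-points would be approximated, hence guessed,
   and the guess would have a limit point inside [M]. *)
Lemma not_cofw_sup beta eta : beta ∈ M -> limit_ordinal beta -> ~ cofk H kappa beta ->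
  eta ∈ beta -> (forall m, m ∈ M -> m ∈ beta -> m ∈ eta) -> unb M eta -> ~ cofw H eta.
Proof.
move=> bM lb nc eb Mb uM [a Ha [ae ua nla]].
have ob := lim_ord lb; have oe := ord_elem ob eb.
(* The points of [a] need not be in [M]; each is replaced by the least point of [M] that is not
   below it. *)
pose ismin x m := [/\ m ∈ M, m ∈ eta, ~ m ∈ x & forall m', m' ∈ M -> m' ∈ eta -> ~ m' ∈ x -> ~ m' ∈ m].
have minex x : x ∈ eta -> exists m, ismin x m.
  move=> xe; have [|m [om [mM me mx] mm]] := @ord_least V (fun m => [/\ m ∈ M, m ∈ eta & ~ m ∈ x]).
    have [m mM [xm me]] := uM _ xe; exists m; first exact: ord_elem me.
    by split=> //; exact: elem_asym.
  by exists m; split=> // m' m'M m'e m'x /mm; apply.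
pose d := sep eta (fun m => exists2 x, x ∈ a & ismin x m).
have dM : ext d `<=` ext M by move=> z /sepE[_ [x _ []]].
have de : ext d `<=` ext eta by move=> z /sepE[].
have ud : unb d eta.
  move=> y ye; have [x xa [yx xe]] := ua _ ye; have [m mP] := minex _ xe.
  have [mM me mx _] := mP; exists m; first by apply/sepE; split=> //; exists x.
  have om := ord_elem oe me; have ox := ord_elem oe xe.
  by split=> //; apply: ord_lt_le yx _ => //; apply: ord_leP.
(* Between two members m < m' of [d] lies a point [x] of [a] with m < x ≤ m'; so a limit point of
   [d] is one of [a]. *)
have nld z : z ∈ eta -> ~ limit_point d z.
  move=> ze [lz uz]; apply: (nla z ze); split=> // y yz.
  have oz := lim_ord lz.
  have [m md [ym mz]] := uz _ yz; have [m' m'd [mm' m'z]] := uz _ mz.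
  have /sepE[m'e [x xa [_ _ m'x m'min]]] := m'd.
  have ox := ord_elem oe (ae _ xa); have om := ord_elem oz mz.
  have mx : m ∈ x by apply: contrapT => mx; apply: (m'min m) => //; [exact: dM|exact: de].
  exists x => //; split; first exact: ord_trans ym mx.
  have om' := ord_elem oz m'z.
  by apply: ord_le_lt m'z => //; apply: ord_leP.
have db : ext d `<=` ext beta by move=> z /de ze; apply: ord_trans ze eb.
have init x : x ∈ eta -> cap d x ∈ M by apply: M_initial.
have [e eM [esub eE]] : exists2 e, e ∈ M & ext e `<=` ext beta /\ forall z, z ∈ M -> z ∈ d <-> z ∈ e.
  apply: guess => // Z ZM kZ; have [b bbM [bb bZ]] := M_bound bM lb nc ZM kZ.
  exists (cap (cap d b) Z); first by apply: M_cap => //; apply: init; apply: Mb.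
  rewrite eqEsubset; split=> z; first by move=> /capE[/capE[]].
  by move=> [zd zZ]; apply/capE; split=> //; apply/capE; split=> //; apply: bZ => //; exact: db.
have ue : unb e beta.
  move=> x0 x0b; apply: contrapT => h.
  have [x xM [xb hx]] : exists2 x, x ∈ M & x ∈ beta /\ forall y, y ∈ e -> ~ x ∈ y.
    apply: TV; first by dfn.
    exists x0; first by apply: HT x0b; exact: M_H.
    by split=> // y ye xy; apply: h; exists y => //; split=> //; exact: esub.
  have [y yd [xy ye]] := ud _ (Mb _ xM xb).
  by apply: (hx y) => //; apply/eE => //; exact: dM.
(* Without limit points below [beta], [e] would be a ladder on [beta], and [beta] would have small
   cofinality. *)
have [z zM [zb lz]] : exists2 z, z ∈ M & z ∈ beta /\ limit_point e z.
  apply: TV; first by dfn.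
  apply: contrapT => h; apply: nc; apply: cofw_cofk => //; exists e; first exact: M_H.
  split=> // z zb lz; apply: h; exists z => //; apply: HT zb; exact: M_H.
have ze := Mb _ zM zb; apply: (nld z ze).
(* Both cuts are in [M] and have the same members in [M], so they are equal, and [z] is a forbidden
   limit point of [d]. *)
have E : cap e z = cap d z.
  apply: M_ext; [exact: M_cap|exact: init|] => w wM.
  by split=> /capE[h wz]; apply/capE; split=> //; apply/eE.
apply: limit_point_mono lz _ => w we wz.
by have : w ∈ cap e z; [apply/capE|rewrite E => /capE[]].
Qed.

Lemma M_least_ord eta : limit_ordinal eta -> (exists2 m, m ∈ M & is_ordinal m /\ ~ m ∈ eta) ->
  exists b, [/\ is_ordinal b, b ∈ M, le_ord eta b & forall m, m ∈ M -> m ∈ b -> m ∈ eta].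
Proof.
move=> le [b0 b0M [ob0 b0e]]; have oe := lim_ord le.
have [|b [ob [bM be] bmin]] := @ord_least V (fun b => b ∈ M /\ ~ b ∈ eta); first by exists b0.
exists b; split=> //; first exact: ord_leP.
by move=> m mM mb; apply: contrapT => me; apply: (bmin m).
Qed.

(** Let [b] be the least ordinal of [M] not below [eta]. If [eta < b], then [eta] is the supremum of
    [M ∩ b]. Large cofinality of [b] contradicts [not_cofw_sup]; small cofinality gives a cofinal
    subset of [b] included in [M], with points above [eta]. *)
Lemma M_cofw_closed eta : limit_ordinal eta -> unb M eta -> cofw H eta ->
  (exists2 b, b ∈ M & is_ordinal b /\ ~ b ∈ eta) -> eta ∈ M.
Proof.
move=> le uM cw [b0 b0M [ob0 b0e]]; have oe := lim_ord le.
have [|b [ob bM [eb|-> //] Mb]] := M_least_ord le; first by exists b0.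
have lb : limit_ordinal b.
  split=> //; first by exists eta.
  move=> x0 x0b; apply: contrapT => h.
  have [x xM [xb hx]] : exists2 x, x ∈ M & x ∈ b /\ forall y, y ∈ b -> ~ x ∈ y.
    apply: TV; first by dfn.
    exists x0; first by apply: HT x0b; exact: M_H.
    by split=> // y yb xy; apply: h; exists y.
  by apply: (hx eta eb); apply: Mb.
case: (pselect (cofk H kappa b)) => [ck|nck]; last first.
  by case: (not_cofw_sup bM lb nck eb Mb uM).
have [a aM [ab ua ka]] : exists2 a, a ∈ M & [/\ ext a `<=` ext b, unb a b & ksmall H kappa a].
  by apply: TV => //; dfn.
have [y ya [ey yb]] := ua _ eb.
have yM := ksmall_subM aM ka ya.
by case: (elem_asym ey (Mb _ yM yb)).
Qed.


(* Woodin's argument against [M] being cofinal in [gamma]: the unavoidable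
   points of a ladder system [L ∈ M] are unbounded in [gamma], and they belong
   to [M] because [M ∩ gamma] itself is unbounded and [omega]-closed. *)
Definition ladder_closed gamma L W := forall xi, xi ∈ gamma -> forall a, a ∈ L ->
  ext a `<=` ext xi -> unb a xi -> limit_point W xi -> xi ∈ W.
(** [L] is a set of ladders rather than a function: a ladder [a] belongs to its own supremum [xi].
    The point [i] occurs on a ladder of some member of every omega-closed unbounded [W]. *)
Definition unavoidable gamma L i := forall W, H W -> unb W gamma -> ladder_closed gamma L W ->
  exists2 a, a ∈ L & exists2 xi, xi ∈ W & [/\ unb a xi, ext a `<=` ext xi & i ∈ a].
Definition ladder_system gamma L := [/\
  forall a, a ∈ L -> forall xi, xi ∈ gamma -> ext a `<=` ext xi -> unb a xi ->
    forall z, z ∈ xi -> ~ limit_point a z,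
  forall a, a ∈ L -> forall a', a' ∈ L -> forall xi, xi ∈ gamma ->
    ext a `<=` ext xi -> ext a' `<=` ext xi -> unb a xi -> unb a' xi -> a = a' &
  forall x, x ∈ gamma -> exists2 i, i ∈ gamma & x ∈ i /\ unavoidable gamma L i].

(** The ladders are chosen inside a thin cofinal set [K]. If no point above [x0] were unavoidable,
    each such [i ∈ K] would be avoided by some [Wf i]. Thinness lets an omega-sequence meet all
    relevant [Wf i] cofinally; its supremum [xi] lies in each of them, in particular in [Wf i] for a
    point [i] on the ladder of [xi]. *)
Lemma ladder_system_ex gamma : gamma ∈ M -> limit_ordinal gamma -> ~ cofk H kappa gamma ->
  exists2 L, H L & ladder_system gamma L.
Proof.
move=> gM lg nc; have og := lim_ord lg; have Hg := M_H gM.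
have [K [Kg uK Kthin]] := thin_cofinal lg.
pose ladder xi a := [/\ ext a `<=` ext (cap K xi), unb a xi & forall z, z ∈ xi -> ~ limit_point a z].
pose lad xi := if pselect (exists a, ladder xi a) is left h then sval (cid h) else xi.
have ladP xi a : ladder xi a -> ladder xi (lad xi).
  by move=> la; rewrite /lad; case: pselect => [h|[]]; [case: cid|exists a].
pose S := sep gamma (fun xi => limit_ordinal xi /\ exists a, ladder xi a).
pose L := repl lad S.
have LE a : a ∈ L -> exists xi, [/\ xi ∈ gamma, limit_ordinal xi, a = lad xi & ladder xi a].
  by move=> /replE[xi /sepE[xg [lx [b hb]]] ->]; exists xi; split=> //; exact: ladP hb.
have Lsub xi a : ladder xi a -> ext a `<=` ext xi by move=> [h _ _] z /h /capE[].
have LE' a xi : a ∈ L -> xi ∈ gamma -> ext a `<=` ext xi -> unb a xi -> a = lad xi /\ ladder xi a.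
  move=> /LE[xi' [x'g lx' aE la]] xg ax ua; have [_ ua' _] := la.
  suff -> : xi = xi' by [].
  by apply: (unb_unique _ _ ua ua') => //; [exact: ord_elem xg|exact: lim_ord|exact: Lsub].
exists L.
  apply: (H_repl theta_regular) => [|xi /sepE[xg [_ [b /ladP hl]]]].
    by apply: (H_sep theta_regular).
  by apply: Hsub (Lsub _ _ hl); apply: HT xg.
split.
- by move=> a aL xi xg ax ua; have [_ []] := LE' _ _ aL xg ax ua.
- move=> a aL a' a'L xi xg ax a'x ua ua'.
  by rewrite (LE' _ _ aL xg ax ua).1 (LE' _ _ a'L xg a'x ua').1.
move=> x0 x0g; apply: contrapT => noi.
pose good i W := [/\ H W, unb W gamma, ladder_closed gamma L W &
  ~ exists2 a, a ∈ L & exists2 xi, xi ∈ W & [/\ unb a xi, ext a `<=` ext xi & i ∈ a]].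
have Wex i : i ∈ gamma -> x0 ∈ i -> exists W, good i W.
  move=> ig xi; apply: contrapT => nW; apply: noi; exists i => //; split=> // W HW uW cW.
  by apply: contrapT => h; apply: nW; exists W.
pose Wf i := if pselect (exists W, good i W) is left h then sval (cid h) else i.
have WfP i : i ∈ gamma -> x0 ∈ i -> good i (Wf i).
  by move=> ig xi; rewrite /Wf; case: pselect => [h|[]]; [case: cid|exact: Wex].
(* One step passes a point of [K] and, for every relevant [i ∈ K] below [x], a point of [Wf i];
   thinness bounds these points below [gamma]. *)
have step x : x ∈ gamma -> exists b y, y ∈ gamma /\
    [/\ b ∈ K, x ∈ b, b ∈ y & forall i, i ∈ K -> i ∈ x -> x0 ∈ i ->
        exists2 w, w ∈ Wf i & x ∈ w /\ w ∈ y].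
  move=> xg.
  pose wit i w := [/\ w ∈ Wf i, x ∈ w & w ∈ gamma].
  pose g i := if pselect (exists w, wit i w) is left h then sval (cid h) else x.
  have gg i : g i ∈ gamma by rewrite /g; case: pselect => // h; case: cid => w [].
  have [b bg bP] := Kthin x g xg (fun k _ _ => gg k).
  have [c cg [xc bc]] := lim_two lg xg bg.
  have [k kK [ck kg]] := uK _ cg; have ok' := ord_elem og kg.
  exists k, (adj k k); split; first exact: lim_succ.
  split=> //; first exact: ord_trans xc ck; first by apply/adjE; right.
  move=> i iK ix xi; have [_ uW _ _] := WfP i (Kg _ iK) xi.
  have [h1 h2 h3] : wit i (g i).
    rewrite /g; case: pselect => [h|[]]; first by case: cid.
    by have [w wW [xw wg]] := uW _ xg; exists w.
  exists (g i) => //; split=> //; apply/adjE; left.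
  exact: ord_trans (bP _ iK ix) (ord_trans ok' bc ck).
have [x [b [x00 xbP]]] := step_sequence step x0g.
have xg n : x n ∈ gamma by case: (xbP n).
have ox n : is_ordinal (x n) by apply: ord_elem (xg n).
have bK n : b n ∈ K by case: (xbP n) => _ [].
have xb n : x n ∈ b n by case: (xbP n) => _ [].
have bx n : b n ∈ x n.+1 by case: (xbP n) => _ [].
pose xi := seqsup x.
have lx : limit_ordinal xi := seqsup_lim ox xb bx; have oxi := lim_ord lx.
have bxi : ext (nrange b) `<=` ext xi by move=> _ /nrangeE[n ->]; exact: seqb_sup.
have ub : unb (nrange b) xi := seq_unb ox xb bx.
have nlb z : z ∈ xi -> ~ limit_point (nrange b) z := @seq_nolim _ _ _ ox xb bx z.
(* Otherwise [xi = gamma] has cofinality omega, which [cofw_cofk] excludes. *)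
have xig : xi ∈ gamma.
  have : le_ord xi gamma.
    by apply: ord_sub_le => // z /seqsupE[n zx]; exact: ord_trans zx (xg n).
  case=> // e; case: nc; apply: cofw_cofk => //; rewrite -e.
  exists (nrange b) => //; apply: Hsub Hg _; rewrite -e; exact: bxi.
(* The points [b n] witness that [xi] has a ladder inside [K]; the chosen [lad xi] may be a
   different one. *)
have lab : ladder xi (nrange b).
  split=> // z zb; apply/capE; split; last exact: bxi.
  by move/nrangeE: zb => [n ->].
have [aK ua _] := ladP _ _ lab; set a := lad xi in aK ua.
have aL : a ∈ L by apply: mem_repl; apply/sepE; split=> //; split=> //; exists (nrange b).
have asub : ext a `<=` ext xi by move=> z /aK /capE[].
have x0xi : x0 ∈ xi by rewrite -x00; exact: seq_sup ox xb bx 0.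
have [i ia [x0i ixi]] := ua _ x0xi.
have /capE[iK _] := aK _ ia.
have [_ _ cW nW] := WfP i (Kg _ iK) x0i.
apply: nW; exists a => //; exists xi; last by [].
(* Once [i] is below [x m], every later step of the sequence contributes a point of [Wf i], so [xi]
   is a limit point of it. *)
apply: cW xig _ aL asub ua _; split=> // y /seqsupE[n yx].
have /seqsupE[m im] := ixi.
pose k := maxn m n.
have [_ [_ _ _ /(_ i iK)]] := xbP k.
case=> //; first by apply: ord_lt_le im (seq_le ox xb bx (leq_maxl m n)).
move=> w wW [xw wx]; exists w => //; split; last by apply/seqsupE; exists k.+1.
have yk : y ∈ x k by apply: ord_lt_le yx (seq_le ox xb bx (leq_maxr m n)).
by apply: ord_trans yk xw; apply: ord_elem wx.
Qed.

(** The set [Q] of unavoidable points is in [M] and would be included in [M], hence small; being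
    unbounded, it would give [gamma] small cofinality. *)
Lemma M_not_cofinal gamma : gamma ∈ M -> limit_ordinal gamma -> ~ cofk H kappa gamma ->
  ~ unb M gamma.
Proof.
move=> gM lg nc uM; have og := lim_ord lg.
have [L LM [L1 L2 L3]] : exists2 L, L ∈ M & ladder_system gamma L.
  apply: TV; last exact: ladder_system_ex.
  by rewrite /ladder_system /unavoidable /ladder_closed; dfn.
pose Q := sep gamma (unavoidable gamma L).
have QM : Q ∈ M by apply: M_sep => //; rewrite /unavoidable /ladder_closed; dfn.
have uQ : unb Q gamma.
  move=> x /L3[i ig [xi iQ]]; exists i => //; exact/sepE.
have Wg : ext (sep gamma (ext M)) `<=` ext gamma by move=> z /sepE[].
have LM' a : a ∈ L -> H a by move=> aL; apply: HT aL; exact: M_H.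
apply: nc; exists Q; first exact: M_H.
split=> // [z /sepE[]//|]; apply: subM_ksmall => // i /sepE[ig iQ].
have [||| a aL [xi /sepE[xg xM] [ua ax ia]]] := iQ (sep gamma (ext M)).
- by apply: (H_sep theta_regular); exact: M_H.
- by move=> x /uM[y yM [xy yg]]; exists y => //; apply/sepE.
- move=> xi xg a aL ax ua [lx uW]; apply/sepE; split=> //.
  apply: M_cofw_closed => //.
  + by move=> y /uW[z /sepE[zg zM] yz]; exists z.
  + exists a; first exact: LM'.
    by split=> //; exact: L1 ua.
  + have [b bM [xb bg]] := uM _ xg; exists b => //; split; first exact: ord_elem bg.
    exact: elem_asym.
have lx : limit_ordinal xi.
  split; first exact: ord_elem xg.
    by exists i; exact: ax.
  by move=> y /ua[z za [yz zx]]; exists z.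
(* The ladder is definable from [L] and [xi], being the only one in [L] on [xi]; its members then
   follow by [M_ladder]. *)
have aM : a ∈ M.
  apply: (@MU (fun a => [/\ a ∈ L, ext a `<=` ext xi & unb a xi])) => //; first by dfn.
    exact: LM'.
  by move=> a' _ [a'L a'x ua']; exact: L2 xg a'x ax ua' ua.
exact: (M_ladder aM (lim_ord lx) ax (L1 _ aL _ xg ax ua)).
Qed.

Lemma sup_M gamma : gamma ∈ M -> limit_ordinal gamma -> ~ cofk H kappa gamma ->
  exists2 eta, eta ∈ gamma &
    [/\ limit_ordinal eta, unb M eta & forall m, m ∈ M -> m ∈ gamma -> m ∈ eta].
Proof.
move=> gM lg nc; have og := lim_ord lg.
have [b bg bP] := not_unb_bound lg (M_not_cofinal gM lg nc).
pose s := sep gamma (ext M).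
have os z : z ∈ s -> is_ordinal z by move=> /sepE[zg _]; apply: ord_elem zg.
case: (sup_cases os) => [e|[m /sepE[mg mM] mmax]|[ls [us ss]]].
- case: (@empE V (emp V)); rewrite -{2}e; apply/sepE; split; [exact: lim_emp|exact: M_emp].
- have /mmax h : adj m m ∈ s by apply/sepE; split; [exact: lim_succ|exact: M_adj].
  have om := ord_elem og mg.
  have mm : m ∈ adj m m by apply/adjE; right.
  by case: (@elem_irr _ m); exact: ord_lt_le mm h.
- exists (union s).
    have ob := ord_elem og bg; apply: ord_le_lt bg => //.
    apply: ord_sub_le => //; first exact: lim_ord.
    by move=> z /unionE[y /sepE[yg yM] zy]; apply: ord_trans zy (bP _ yM yg).
  split=> // [x /us[y /sepE[yg yM] h]|m mM mg]; first by exists y.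
  by apply: ss; apply/sepE.
Qed.


(** * The second use of guessing: a thread on [gamma] *)

Section Thread.
Variables (gamma T eta C : V).
Hypothesis gM : gamma ∈ M.
Hypothesis lg : limit_ordinal gamma.
Hypothesis nc : ~ cofk H kappa gamma.
Hypothesis TM : T ∈ M.
Hypothesis Tg : presq H kappa T gamma.
Hypothesis eg : eta ∈ gamma.
Hypothesis le : limit_ordinal eta.
Hypothesis ue : unb M eta.
Hypothesis Mg : forall m, m ∈ M -> m ∈ gamma -> m ∈ eta.
Hypothesis Ce : club C eta.
Hypothesis CT : forall beta, beta ∈ eta -> limit_point C beta -> cofk H kappa beta -> cap_in T C beta.
Let og : is_ordinal gamma := lim_ord lg.
Let oe : is_ordinal eta := lim_ord le.

Let C_sub : ext C `<=` ext eta. Proof. by case: Ce. Qed.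

(** The width of the sequence enters here: for [z ∈ M] the level at [z] is covered by a small set of
    [M], and such a set is included in [M]. *)
Lemma T_level_M z c : z ∈ M -> z ∈ gamma -> limit_ordinal z -> cofk H kappa z ->
  c ∈ T -> club c z -> c ∈ M.
Proof.
move=> zM zg lz cz cT cc; have [_ hs _] := Tg zg lz cz.
have [s sM [sT ks]] : exists2 s, s ∈ M & (forall c, c ∈ T -> club c z -> c ∈ s) /\ ksmall H kappa s.
  by apply: TV => //; dfn.
by apply: (ksmall_subM sM ks); exact: sT.
Qed.

Lemma cap_C_M z : z ∈ M -> z ∈ gamma -> limit_point C z -> cofk H kappa z ->
  cap C z ∈ T /\ cap C z ∈ M.
Proof.
move=> zM zg lz cz; have ze := Mg zM zg; have h := CT ze lz cz; split=> //.
have [lz' _] := lz.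
by apply: (@T_level_M z) => //; exact: (club_cap oe Ce ze lz).
Qed.

(** Only a limit supremum [z] of [A = Z ∩ C ∩ x] needs more than adding a point. Smallness of [Z]
    gives [z] small cofinality, so coherence and [T_level_M] put [C ∩ z] in [M], and [A] is its
    intersection with [Z]. *)
Lemma C_approximated Z x : Z ∈ M -> ksmall H kappa Z -> x ∈ eta -> cap (cap Z C) x ∈ M.
Proof.
move=> ZM kZ; have ZsM := ksmall_subM ZM kZ.
elim/elem_ind: x => x IH xe; set A := cap (cap Z C) x.
have AE z : z ∈ A <-> [/\ z ∈ Z, z ∈ C & z ∈ x].
  by rewrite !capE; split=> [[[]]|[]].
have ox := ord_elem oe xe.
case: (@sup_cases _ A) => [z /AE[_ _]|->|[m /AE[mZ mC mx] mmax]|[lu [uu Au]]].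
- exact: ord_elem.
- exact: M_emp.
- have -> : A = adj (cap (cap Z C) m) m.
    apply: set_eq => z; split=> [h|/adjE[/capE[/capE[zZ zC] zm]|->]].
    + apply/adjE; case: (mmax _ h) => [zm|->]; last by right.
      by left; apply/capE; split=> //; apply/capE; case/AE: h.
    + by apply/AE; split=> //; exact: ord_trans zm mx.
    + exact/AE.
  apply: M_adj; last exact: ZsM.
  by apply: IH => //; exact: ord_trans mx xe.
set z := union A in lu uu Au.
have ze : z ∈ eta.
  apply: ord_le_lt xe => //; apply: ord_sub_le => //; first exact: lim_ord.
  by move=> w /unionE[y /AE[_ _ yx] wy]; exact: ord_trans wy yx.
have [Hz oz] : H z /\ is_ordinal z.
  by split; [exact: (@HT z gamma (M_H gM) (ord_trans og ze eg))|exact: lim_ord].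
(* If [b] is the least ordinal of [M] not below [z], then [z = b] or [z] is the supremum of [Z ∩ b],
   because [Z] is included in [M]. *)
have zM : z ∈ M.
  have [|b [ob bM zb bmin]] := @M_least_ord z lu.
    have [m mM [zm me]] := ue ze; exists m => //; split; first exact: ord_elem me.
    exact: elem_asym.
  case: zb => [zb|-> //]; have ZbM := M_cap ZM bM.
  have uz : unb (cap Z b) z.
    move=> y /uu[w wA [yw wz]]; exists w => //; apply/capE; split; first by case/AE: wA.
    exact: ord_trans wz zb.
  have sz w : w ∈ cap Z b -> w ∈ z by move=> /capE[wZ wb]; apply: bmin => //; exact: ZsM.
  apply: (@MU (fun y => [/\ is_ordinal y, unb (cap Z b) y & forall w, w ∈ cap Z b -> w ∈ y])) => //.
    by dfn.
  by move=> y _ [oy uy sy]; exact: (unb_unique (a := cap Z b)).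
have lz : limit_point C z.
  by split=> // y /uu[w /AE[_ wC _] h]; exists w.
have zg : z ∈ gamma by exact: ord_trans ze eg.
have cz : cofk H kappa z.
  exists A; first by apply: Hsub Hz _.
  by split=> //; apply: ksmall_sub kZ _ => w /AE[].
have [_ CzM] := cap_C_M zM zg lz cz.
have -> : A = cap Z (cap C z).
  apply: set_eq => w; split=> [wA|/capE[wZ /capE[wC wz]]].
    by apply/capE; split; [case/AE: wA|apply/capE; split; [case/AE: wA|exact: Au]].
  apply/AE; split=> //; move/unionE: wz => [y /AE[_ _ yx] wy].
  exact: ord_trans wy yx.
exact: M_cap.
Qed.

(** Points of [M] and of [C] alternate for omega steps. Their supremum is below [eta] by
    [not_cofw_sup], in [C] by closure and in [M] by [M_cofw_closed]. *)
Lemma C_meets_M x : x ∈ eta -> exists2 y, y ∈ C & y ∈ M /\ x ∈ y.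
Proof.
move=> xe; have [x0 x0M [xx0 x0e]] := ue xe.
have [_ uC cC] := Ce.
have step y : y ∈ M /\ y ∈ eta -> exists b z, (z ∈ M /\ z ∈ eta) /\ [/\ b ∈ C, y ∈ b & b ∈ z].
  move=> [yM ye]; have [c cC' yc] := uC _ ye; have [m mM [cm me]] := ue (C_sub cC').
  by exists c, m.
have [s [b [s0 sP]]] := step_sequence step (conj x0M x0e).
have os n : is_ordinal (s n) by have [[_ h] _] := sP n; exact: ord_elem h.
have sb n : s n ∈ b n by have [_ []] := sP n.
have bs n : b n ∈ s n.+1 by have [_ []] := sP n.
have lx := seqsup_lim os sb bs; set xi := seqsup s in lx.
have ub : unb (nrange b) xi := @seq_unb _ _ _ os sb bs.
have bxi : ext (nrange b) `<=` ext xi by move=> _ /nrangeE[n ->]; exact: (seqb_sup bs).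
have cw a : H a -> xi = a -> cofw H a.
  move=> Ha e; subst a; exists (nrange b); first exact: Hsub Ha _.
  by split=> // z; exact: seq_nolim.
have Heta : H eta by apply: HT eg; exact: M_H.
have xie : xi ∈ eta.
  have : le_ord xi eta.
    apply: ord_sub_le => //; first exact: lim_ord.
    by move=> z /seqsupE[n zs]; have [[_ h] _] := sP n; exact: ord_trans zs h.
  case=> // e; case: (not_cofw_sup gM lg nc eg Mg ue); exact: cw.
exists xi; last split.
- apply: cC => //; split=> // y /ub[_ /nrangeE[n ->] h]; exists (b n) => //.
  by have [_ []] := sP n.
- apply: M_cofw_closed => //.
  + move=> y /seqsupE[n ys]; exists (s n); first by have [[]] := sP n.
    by split=> //; exact: (seq_sup os sb bs).
  + by apply: cw => //; exact: HT xie.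
  + by exists gamma => //; split=> // gx; case: (elem_asym gx); exact: ord_trans xie eg.
- apply: ord_trans xx0 _; first exact: lim_ord.
  by rewrite -s0; exact: (seq_sup os sb bs).
Qed.

Lemma thread_ex : exists2 D, H D & thread H kappa T gamma D.
Proof.
have Hg := M_H gM.
have [e eM [esub eE]] : exists2 e, e ∈ M & ext e `<=` ext gamma /\ forall z, z ∈ M -> z ∈ C <-> z ∈ e.
  apply: guess => // [z /C_sub ze|Z ZM kZ]; first exact: ord_trans ze eg.
  (* The bound [b] is in [M], hence below [eta], so only a proper initial segment of [C] is to be
     approximated. *)
  have [b bM [bg bZ]] := M_bound gM lg nc ZM kZ.
  exists (cap (cap Z C) b); first by apply: C_approximated => //; exact: Mg.
  rewrite eqEsubset; split=> z; first by move=> /capE[/capE[]].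
  move=> [zC zZ]; apply/capE; split; first exact/capE.
  by apply: bZ => //; apply: ord_trans (C_sub zC) eg.
have uE : unb e gamma.
  move=> x0 x0g; apply: contrapT => h.
  have [x xM [xg hx]] : exists2 x, x ∈ M & x ∈ gamma /\ forall y, y ∈ e -> ~ x ∈ y.
    apply: TV; first by dfn.
    exists x0; first exact: HT x0g.
    by split=> // y ye xy; apply: h; exists y => //; split=> //; exact: esub.
  have [y yC [yM xy]] := C_meets_M (Mg xM xg).
  by apply: (hx y) => //; apply/eE.
have key z : z ∈ M -> z ∈ gamma -> limit_point e z -> cofk H kappa z ->
    cap e z ∈ T /\ club (cap e z) z.
  move=> zM zg lz cz; have Hz := M_H zM; have oz := ord_elem og zg; have ze := Mg zM zg.
  have [a Ha [az ua ka]] := cz; have [_ ulz] := lz.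
  have nextex y : y ∈ a -> exists w, [/\ w ∈ e, y ∈ w & w ∈ z].
    by move=> /az /ulz[w we [yw wz]]; exists w.
  pose nxt y := if pselect (y ∈ a) is left h then sval (cid (nextex y h)) else y.
  have nxtP y : y ∈ a -> [/\ nxt y ∈ e, y ∈ nxt y & nxt y ∈ z].
    by move=> ya; rewrite /nxt; case: pselect => // h; case: cid.
  have [a' a'M [a'e ua' ka']] : exists2 a', a' ∈ M & [/\ ext a' `<=` ext (cap e z), unb a' z & ksmall H kappa a'].
    have ezM : cap e z ∈ M by exact: M_cap.
    apply: TV; first by dfn.
    have sub : ext (repl nxt a) `<=` ext (cap e z).
      by move=> _ /replE[y /nxtP[ye _ yz] ->]; apply/capE.
    exists (repl nxt a); first by apply: Hsub sub; exact: M_H.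
    split=> // [x /ua[y ya [xy yz]]|].
      have [h1 h2 h3] := nxtP _ ya; exists (nxt y); first exact: mem_repl.
      by split=> //; apply: ord_trans xy h2; exact: ord_elem h3.
    by apply: ksmall_image ka _ => y /nxtP[_ _ h]; exact: HT h.
  have a'sM := ksmall_subM a'M ka'.
  have lC : limit_point C z.
    have [lz' _] := lz; split=> // x /ua'[y ya' h]; exists y => //.
    by apply/eE; [exact: a'sM|have /capE[] := a'e _ ya'].
  have [CzT CzM] := cap_C_M zM zg lC cz.
  have -> : cap e z = cap C z.
    apply: M_ext => //; first exact: M_cap.
    by move=> w wM; split=> /capE[h wz]; apply/capE; split=> //; apply/eE.
  by split=> //; exact: (club_cap oe Ce ze lC).
exists e; first exact: M_H.
split; first split=> //.
- by move=> x /uE[y ye [xy _]]; exists y.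
- move=> z0 z0g lz0; apply: contrapT => nz0.
  have [z zM [zg lz nz]] : exists2 z, z ∈ M & [/\ z ∈ gamma, limit_point e z & ~ z ∈ e].
    apply: TV; first by dfn.
    by exists z0 => //; exact: HT z0g.
  (* The missing [z] may have large cofinality, where [key] says nothing. A limit point [r] of [e]
     beyond [z] of cofinality omega is used instead: [e ∩ r] is closed in [r], so it contains
     [z]. *)
  have [r rM [rg zr lr cr]] : exists2 r, r ∈ M & [/\ r ∈ gamma, z ∈ r, limit_point e r & cofw H r].
    apply: TV; first by dfn.
    (* The least limit point of [e] above [z] has [e] between [z] and [r] as a ladder. If there were
       none, [e] above [z] would be a ladder on [gamma]. *)
    have [|r [or [rg zr lr] rmin]] := @ord_least V (fun r => [/\ r ∈ gamma, z ∈ r & limit_point e r]).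
      apply: contrapT => h; apply: nc; apply: cofw_cofk => //; exists (sep e (fun y => z ∈ y)).
        by apply: (H_sep theta_regular); exact: M_H.
      split=> [y /sepE[/esub]//|x xg|r rg lr].
        have [c cg [xc zc]] := lim_two lg xg zg; have [y ye [cy yg]] := uE _ cg.
        have oy := ord_elem og yg.
        exists y; first by apply/sepE; split=> //; exact: ord_trans zc cy.
        by split=> //; exact: ord_trans xc cy.
      have or := ord_elem og rg; apply: h; exists r => //; split=> //.
        have [[_ [x xr] _] ur] := lr; have [y /sepE[_ zy] [_ yr]] := ur _ xr.
        exact: ord_trans zy yr.
      by apply: limit_point_mono lr _ => y /sepE[].
    have Hr : H r by exact: HT rg.
    exists r => //; split=> //; exists (sep r (fun y => y ∈ e /\ z ∈ y)).
      exact: (H_sep theta_regular).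
    split=> [y /sepE[]//|x xr|r' r'r lr'].
      have [lr0 ur] := lr; have [c cr [xc zc]] := lim_two lr0 xr zr; have [y ye [cy yr]] := ur _ cr.
      have oy := ord_elem or yr.
      exists y; last by split=> //; exact: ord_trans xc cy.
      by apply/sepE; split=> //; split=> //; exact: ord_trans zc cy.
    apply: (rmin r') => //; split; first exact: ord_trans r'r rg.
      have [lr'0 ur'] := lr'; have [_ [x xr'] _] := lr'0; have [y /sepE[_ [_ zy]] [_ yr]] := ur' _ xr'.
      by apply: ord_trans zy yr; exact: lim_ord.
    by apply: limit_point_mono lr' _ => y /sepE[_ []].
  have or := ord_elem og rg.
  have [_ [_ _ cl]] := key r rM rg lr (cofw_cofk rM or cr).
  have /capE[] // : z ∈ cap e r.
  apply: cl => //; apply: limit_point_mono lz _ => y ye yz.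
  by apply/capE; split=> //; exact: ord_trans yz zr.
- move=> z0 z0g lz0 cz0; apply: contrapT => nz0.
  have [z zM [zg lz cz nz]] : exists2 z, z ∈ M & [/\ z ∈ gamma, limit_point e z, cofk H kappa z & ~ cap_in T e z].
    apply: TV; first by dfn.
    by exists z0 => //; exact: HT z0g.
  by have [] := key z zM zg lz cz.
Qed.

End Thread.

(** * No bad ordinals in [H_theta] *)

Lemma no_bad gamma : H gamma -> ~ bad H kappa gamma.
Proof.
move=> Hg0 bg0.
have [gamma1 gM [bg gmin]] : exists2 g, g ∈ M & bad H kappa g /\ forall g', g' ∈ g -> ~ bad H kappa g'.
  apply: TV.
    apply: Dfn_and; first by apply: (Dfn_bad HT M_elementary); dfn_trm.
    by dfn; apply: (Dfn_bad HT M_elementary); dfn_trm.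
  elim/elem_ind: gamma Hg0 bg0 => g IH Hg bg.
  case: (pselect (exists2 g', g' ∈ g & bad H kappa g')) => [[g' g'g bg']|n].
    by apply: (IH g') => //; exact: HT g'g.
  by exists g => //; split=> // g' g'g bg'; apply: n; exists g'.
have [lg nc hT] := bg.
have [T TM [pT nT]] : exists2 T, T ∈ M & presq H kappa T gamma1 /\
    ~ exists2 D, H D & thread H kappa T gamma1 D.
  by apply: TV => //; rewrite /presq /thread; dfn.
have [eta eg [le ue Me]] := sup_M gM lg nc; have og := lim_ord lg.
apply: nT.
suff [C Ce CT] : exists2 C, club C eta & forall beta, beta ∈ eta -> limit_point C beta ->
    cofk H kappa beta -> cap_in T C beta by exact: thread_ex CT.
have Heta : H eta by apply: HT eg; exact: M_H.
case: (pselect (cofk H kappa eta)) => ce.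
  have [[C CT cC] _ h] := pT _ eg le ce; exists C => // beta be lb cb.
  by apply: h CT cC _ _ lb cb; exact: HT be.
have := gmin _ eg; rewrite /bad => nb.
apply: contrapT => nC; apply: nb; split=> //; exists T; first exact: M_H.
split=> [a ae|[D _ [cD hD]]]; first by apply: pT; exact: ord_trans ae eg.
by apply: nC; exists D.
Qed.

(** * From a square sequence to a bad ordinal *)

Lemma cofk_cof_lt beta : limit_ordinal beta -> cofk H kappa beta -> cof_lt kappa beta.
Proof.
move=> lb [a _ [ab ua /ksmall_card[mu muk amu]]]; have ob := lim_ord lb; split=> //.
have [|nu [onu [a0 ca0 ka0] numin]] := @ord_least V (fun nu => exists2 a, cofinal_subset a beta & is_card a nu).
  have [nu anu] := is_card_ex a; exists nu; first by case: anu => -[].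
  by exists a => //; split=> // x /ua[y ya [xy _]]; exists y => //; left.
exists nu.
  split; first by exists a0.
  move=> a' nu' ca' ka'; apply: ord_leP => //; first by case: ka' => -[].
  by move=> /numin; apply; exists a'.
have [nu' anu'] := is_card_ex a.
have onu' : is_ordinal nu' by case: anu' => -[].
have : le_ord nu nu'.
  apply: ord_leP => // /numin; apply; exists a => //; split=> // x /ua[y ya [xy _]].
  by exists y => //; left.
move=> h; apply: ord_le_lt h _ => //.
exact: ord_le_lt (is_card_le anu' (ord_elem ok muk) amu) muk.
Qed.

Lemma cof_lt_cofk beta : limit_ordinal beta -> H beta -> cof_lt kappa beta -> cofk H kappa beta.
Proof.
move=> lb Hb [ob [mu [[a [ab ca] [_ /card_eqPle[amu _]]] _] muk]].
exists a; first exact: Hsub Hb ab.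
split=> // [x xb|].
  (* Cofinality in the statement is weak, x ≤ y; applying it to the successor of [x] gives the
     strict inequality. *)
  have [y ya xy] := ca _ (lim_succ lb xb); exists y => //; split; last exact: ab.
  apply: ord_lt_le xy; first exact: ord_elem (ab _ ya).
  by apply/adjE; right.
by apply: (card_ksmall (mu := mu)) => // z /ab zb; exact: HT zb.
Qed.

(** A square sequence makes [lambda] bad: regularity and [kappa ≤ lambda] rule out small cofinality,
    and the union [T] of all levels satisfies [presq] without a thread. *)
Lemma no_square lambda : regular_cardinal lambda -> le_ord kappa lambda -> H lambda ->
  ~ square (cof_lt kappa) kappa lambda.
Proof.
move=> rl kl Hl [Cs [sq1 sq2 sq3 sq4]].
have ol := reg_ord rl.
have [_ infl cofl] := rl.
have ll : limit_ordinal lambda.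
  split=> //; first exact: infinite_setN0 infl.
  (* If [b] were the last element, {b} would be cofinal in [lambda], and regularity would make
     [lambda] finite. *)
  move=> b bl; apply: contrapT => h.
  have lE x : x ∈ lambda -> x ∈ adj b b.
    move=> xl; apply/adjE.
    have := ord_leP (ord_elem ol bl) (ord_elem ol xl); apply => bx; apply: h.
    by exists x.
  pose s := upair b b.
  have [nu snu] := is_card_ex s.
  have [_ /(_ s nu)/(_ _ snu) ln] := cofl.
  have onu : is_ordinal nu by case: snu => -[].
  apply: infl; have [_ /card_eqPle[_ nus]] := snu.
  apply: (@card_le_finite _ _ _ [set b; b]); last exact: finite_set2.
  apply: (@card_le_trans _ _ _ (ext nu)).
    apply: subset_card_le; apply: ord_le_sub => //; apply: ln; split=> [x /upairE[]->//|x xl].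
    exists b; first by apply/upairE; left.
    by move/lE: xl => /adjE[]; [left|right].
  by apply: card_le_trans nus _; apply: subset_card_le => x /upairE.
have nck : ~ cofk H kappa lambda.
  move=> [a _ [al ua /ksmall_card[mu muk amu]]]; have [_ /(_ a)] := cofl.
  have [nu anu] := is_card_ex a => /(_ nu)/(_ _ anu) h.
  have hl : le_ord lambda nu by apply: h; split=> // x /ua[y ya [xy _]]; exists y => //; left.
  have nuk : nu ∈ kappa by exact: ord_le_lt (is_card_le anu (ord_elem ok muk) amu) muk.
  have onu : is_ordinal nu by case: anu => -[].
  have nul : nu ∈ lambda by exact: ord_lt_le nuk kl.
  exact: (@elem_irr _ nu (ord_lt_le onu nul hl)).
pose dom a := [/\ limit_ordinal a, cof_lt kappa a & a ∈ lambda].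
pose T := union (repl Cs (sep lambda (fun a => dom a))).
have TE c : c ∈ T <-> exists2 a, dom a & c ∈ Cs a.
  split=> [/unionE[_ /replE[a /sepE[_ da] ->] cC]|[a da cC]]; first by exists a.
  apply/unionE; exists (Cs a) => //; apply: mem_repl; apply/sepE; split=> //.
  by case: da.
have HC a c : dom a -> c ∈ Cs a -> H c.
  move=> da cC; have [cs _ _] := sq2 _ da _ cC; apply: Hsub cs.
  by have [_ _ al] := da; exact: HT al.
have kC a : dom a -> ksmall H kappa (Cs a).
  move=> da; have [_ [mu [_ /card_eqPle[h _]] muk]] := sq1 _ da.
  by apply: (card_ksmall _ muk h) => c; exact: HC.
have HCs a : dom a -> H (Cs a).
  move=> da; have [mu muk h] := ksmall_card (kC _ da).
  apply: (H_all theta_regular) => [|c]; last exact: HC.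
  apply: card_lt_mono h _; first exact: reg_ord theta_regular.
  by apply: (H_card theta_regular); apply: HT muk; exact: M_H.
have TC a c : dom a -> c ∈ T -> club c a -> c ∈ Cs a.
  move=> da /TE[a' da' cC] cc; have cc' := sq2 _ da' _ cC.
  suff -> : a = a' by [].
  have [[oa _ _] _ _] := da; have [[oa' _ _] _ _] := da'.
  have [s1 u1 _] := cc; have [s2 u2 _] := cc'.
  apply: (unb_unique (a := c)) => // x xa; [have [y yc xy] := u1 _ xa|have [y yc xy] := u2 _ xa].
    by exists y => //; split=> //; exact: s1.
  by exists y => //; split=> //; exact: s2.
have inT c b : dom b -> set_in (ext c `&` ext b) (Cs b) -> cap_in T c b.
  move=> db [d dC dE]; rewrite /cap_in.
  suff -> : cap c b = d by apply/TE; exists b.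
  by apply: ext_inj; rewrite dE eqEsubset; split=> z /capE.
apply: (no_bad Hl); split=> //; exists T.
  apply: (H_union theta_regular); apply: (H_repl theta_regular).
    exact: (H_sep theta_regular).
  by move=> a /sepE[_]; exact: HCs.
split.
- move=> a al la ca.
  have da : dom a by split=> //; exact: cofk_cof_lt.
  split.
  + have [[c cC] _] := sq1 _ da; exists c; last exact: sq2 cC.
    by apply/TE; exists a.
  + by exists (Cs a); [exact: HCs|split; [move=> c; exact: TC|exact: kC]].
  + move=> c cT cc b Hb lb cb; have [lb0 _] := lb.
    have cb' := cofk_cof_lt lb0 cb.
    apply: inT; last exact: sq3 (TC _ _ da cT cc) _ lb cb'.
    (* A limit point [b] of [c] is at most [a], since [c] is included in [a]; so [b] is below
       [lambda]. *)
    split=> //; apply: ord_le_lt al => //; have [cs _ _] := cc.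
    have ob := lim_ord lb0; apply: ord_sub_le => //; first exact: lim_ord.
    by move=> x /(proj2 lb)[y yc [xy _]]; apply: ord_trans xy (cs _ yc); exact: lim_ord.
- move=> [D HD [cD hD]]; apply: sq4; exists D; split=> // b lb cb bl.
  have [lb0 _] := lb.
  have cbk : cofk H kappa b by apply: cof_lt_cofk => //; exact: HT bl.
  have := hD _ bl lb cbk; have db : dom b by split.
  move=> h; exists (cap D b); last by rewrite eqEsubset; split=> z /capE.
  by apply: TC => //; exact: (club_cap ol cD bl lb).
Qed.

End Guessing.

Theorem theorem7p2 (V : zfc_universe) (theta delta kappa M : V)
    (theta_regular : regular_cardinal theta)
    (M_elementary : elementary (ext M) (Hset theta))
    (kappa_M : is_kappa M kappa)
    (kappa_theta : kappa ∈ theta)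
    (delta_cardinal : is_cardinal delta)
    (delta_kappa : delta ∈ kappa)
    (M_guessing : guessing theta delta M) :
  forall lambda : V,
    regular_cardinal lambda ->
    le_ord kappa lambda ->
    lambda ∈ M ->
    lambda ∈ theta ->
    (exists2 s : V, is_sup (ext M `&` ext lambda) s & s ∈ lambda) ->
    ~ square (cof_lt kappa) kappa lambda.
Proof.
move=> lambda lambda_regular kappa_lambda _ lambda_theta _.
apply: (no_square theta_regular M_elementary kappa_M delta_kappa M_guessing) => //.
exact: (H_ord theta_regular).
Qed.
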